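(* Let $\mathsf{C}$ be a strict braided monoidal category. The category $\mathsf{cocHBr}$ of cocommutative Hopf braces in $\mathsf{C}$ and the category $\mathsf{cocBT}$ of cocommutative brace triples in $\mathsf{C}$ are isomorphic.
   Context: $\mathsf{C}$ is a strict braided monoidal category with tensor product $\otimes$, unit object $K$ and braiding $c$ (not assumed symmetric). For an object $P$ and a morphism $f$, $P\otimes f$ means $id_P\otimes f$ and $f\otimes P$ means $f\otimes id_P$. Algebras, coalgebras, bialgebras and Hopf algebras are internal to $\mathsf{C}$; the tensor product of coalgebras $D,E$ has coproduct $(D\otimes c_{D,E}\otimes E)\circ(\delta_D\otimes\delta_E)$ and counit $\varepsilon_D\otimes\varepsilon_E$, and the tensor product of algebras $A,B$ has product $(\mu_A\otimes\mu_B)\circ(A\otimes c_{B,A}\otimes B)$. A Hopf algebra $H=(H,\eta_H,\mu_H,\varepsilon_H,\delta_H,\lambda_H)$ is a bialgebra with a morphism (antipode) $\lambda_H$ such that $\mu_H\circ(H\otimes\lambda_H)\circ\delta_H=\eta_H\circ\varepsilon_H=\mu_H\circ(\lambda_H\otimes H)\circ\delta_H$; it is cocommutative if $c_{H,H}\circ\delta_H=\delta_H$. Hopf algebra morphisms are morphisms that are both algebra and coalgebra morphisms. Hopf brace: a coalgebra $(H,\varepsilon_H,\delta_H)$ with two Hopf algebra structures $H_1=(H,\eta_H^1,\mu_H^1,\varepsilon_H,\delta_H,\lambda_H^1)$ and $H_2=(H,\eta_H^2,\mu_H^2,\varepsilon_H,\delta_H,\lambda_H^2)$ in $\mathsf{C}$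 such that $\mu_H^2\circ(H\otimes\mu_H^1)=\mu_H^1\circ(\mu_H^2\otimes\Gamma_{H_1})\circ(H\otimes c_{H,H}\otimes H)\circ(\delta_H\otimes H\otimes H)$, where $\Gamma_{H_1}=\mu_H^1\circ(\lambda_H^1\otimes\mu_H^2)\circ(\delta_H\otimes H)$. A morphism of Hopf braces $\mathbb{H}\to\mathbb{B}$ is a morphism $f:H\to B$ in $\mathsf{C}$ such that $f:H_1\to B_1$ and $f:H_2\to B_2$ are Hopf algebra morphisms. A Hopf brace is cocommutative if $c_{H,H}\circ\delta_H=\delta_H$; $\mathsf{cocHBr}$ is the full subcategory of cocommutative Hopf braces. Brace triple: $(H,\gamma_H,T_H)$ with $H=(H,\eta_H,\mu_H,\varepsilon_H,\delta_H,\lambda_H)$ a Hopf algebra in $\mathsf{C}$ with $\lambda_H$ an isomorphism, and morphisms $\gamma_H:H\otimes H\to H$, $T_H:H\to H$ such that (i) $(\gamma_H\otimes H)\circ(H\otimes c_{H,H})\circ(\delta_H\otimes H)=(\gamma_H\otimes H)\circ(H\otimes c_{H,H})\circ((c_{H,H}\circ\delta_H)\otimes H)$; (ii) $\gamma_H$ is a coalgebra morphism; (iii) $\gamma_H\circ(H\otimes\mu_H)=\mu_H\circ(\gamma_H\otimes\gamma_H)\circ(H\otimes c_{H,H}\otimes H)\circ(\delta_H\otimes H\otimes H)$; (iv) $\gamma_H\circ(H\otimes\gamma_H)=\gamma_H\circ((\mu_H\circ(H\otimes\gamma_H)\circ(\delta_H\otimes H))\otimes H)$; (v) $\gamma_H\circ(\eta_H\otimes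 H)=id_H$; (vi) $T_H$ is an isomorphism with (vi.1) $\delta_H\circ T_H=c_{H,H}\circ(T_H\otimes T_H)\circ\delta_H$, (vi.2) $\varepsilon_H\circ T_H=\varepsilon_H$, (vi.3) $\mu_H\circ(H\otimes\gamma_H)\circ((\delta_H\circ T_H)\otimes H)=\mu_H\circ(H\otimes\gamma_H)\circ(((T_H\otimes T_H)\circ\delta_H)\otimes H)$, (vi.4) $\gamma_H\circ(H\otimes T_H)\circ\delta_H=\lambda_H$, (vi.5) $\gamma_H\circ(T_H\otimes H)\circ\delta_H=\lambda_H^{-1}\circ T_H$. A morphism of brace triples $(H,\gamma_H,T_H)\to(B,\gamma_B,T_B)$ is a Hopf algebra morphism $f:H\to B$ with $f\circ\gamma_H=\gamma_B\circ(f\otimes f)$. $\mathsf{cocBT}$ is the full subcategory of brace triples whose underlying Hopf algebra is cocommutative. *)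

(* Defs.v *)
From Stdlib Require Import ProofIrrelevance.

Set Implicit Arguments.
Unset Strict Implicit.
Unset Printing Implicit Defensive.

Declare Scope cat_scope.
Delimit Scope cat_scope with cat.
Open Scope cat_scope.

Reserved Notation "g ∘ f" (at level 40, left associativity).
Reserved Notation "A ⊗ B" (at level 38, left associativity).
Reserved Notation "f ⊠ g" (at level 38, left associativity).

(** * Categories, functors, isomorphism of categories *)

Record category := Category {
  ob :> Type;
  hom : ob -> ob -> Type;
  idm : forall A, hom A A;
  comp : forall A B C, hom B C -> hom A B -> hom A C;
  comp1m : forall A B (f : hom A B), comp (idm B) f = f;
  compm1 : forall A B (f : hom A B), comp f (idm A) = f;
  compA : forall A B C D (h : hom C D) (g : hom B C) (f : hom A B),
    comp h (comp g f) = comp (comp h g) f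
}.
Arguments hom {c} A B.
Arguments idm {c} A.
Arguments comp {c A B C} g f.
Notation "g ∘ f" := (comp g f) : cat_scope.

Record functor (C D : category) := Functor {
  fob :> C -> D;
  fhom : forall A B : C, hom A B -> hom (fob A) (fob B);
  fhom1 : forall A : C, fhom (idm A) = idm (fob A);
  fhomM : forall (A B E : C) (g : hom B E) (f : hom A B),
    fhom (g ∘ f) = fhom g ∘ fhom f
}.

Definition functor_id (C : category) : functor C C :=
  @Functor C C (fun A => A) (fun A B f => f)
    (fun A => eq_refl) (fun A B E g f => eq_refl).

Lemma functor_comp1 (C D E : category) (G : functor D E) (F : functor C D)
  (A : C) : fhom G (fhom F (idm A)) = idm (G (F A)).
Proof. now rewrite !fhom1. Qed.

Lemma functor_compM (C D E : category) (G : functor D E) (F : functor C D)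
  (A B X : C) (g : hom B X) (f : hom A B) :
  fhom G (fhom F (g ∘ f)) = fhom G (fhom F g) ∘ fhom G (fhom F f).
Proof. now rewrite !fhomM. Qed.

Definition functor_comp (C D E : category) (G : functor D E) (F : functor C D) :
  functor C E :=
  @Functor C E (fun A => G (F A)) (fun A B f => fhom G (fhom F f))
    (functor_comp1 G F) (@functor_compM C D E G F).

(* Isomorphism, not mere equivalence: the composites are equal to the
   identity functors. *)
Definition isomorphic_categories (C D : category) : Prop :=
  exists (F : functor C D) (G : functor D C),
    functor_comp G F = functor_id C /\ functor_comp F G = functor_id D.

Definition full_subcategory (C : category) (P : C -> Prop) : category :=
  @Category {A : C | P A}
    (fun A B => hom (proj1_sig A) (proj1_sig B))
    (fun A => idm (proj1_sig A))
    (fun A B E g f => g ∘ f)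
    (fun A B f => comp1m f)
    (fun A B f => compm1 f)
    (fun A B E X h g f => compA h g f).

Definition is_inverse (C : category) (A B : C) (f : hom A B) (g : hom B A) :
  Prop := g ∘ f = idm A /\ f ∘ g = idm B.

Definition is_iso (C : category) (A B : C) (f : hom A B) : Prop :=
  exists g : hom B A, is_inverse f g.

(** * Strict braided monoidal categories *)

(* The identity of A, seen as a morphism to an object equal to A. *)
Definition eq_hom (C : category) (A B : C) (e : A = B) : hom A B :=
  match e in _ = X return hom A X with eq_refl => idm A end.

(* Strictness on objects is equality.  Strictness on morphisms, e.g.
   (f ⊗ g) ⊗ h = f ⊗ (g ⊗ h), equates morphisms whose types are only
   propositionally equal; it is stated by composing with the identities
   [eq_hom], i.e. as naturality of the identity associator and unitors. *)
Record strict_monoidal_category := StrictMonoidalCategory {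
  sm_cat :> category;
  tens : sm_cat -> sm_cat -> sm_cat;
  unit_ob : sm_cat;
  tensm : forall A B A' B' : sm_cat,
    hom A A' -> hom B B' -> hom (tens A B) (tens A' B');
  tensm1 : forall A B, tensm (idm A) (idm B) = idm (tens A B);
  tensmM : forall (A B A' B' A'' B'' : sm_cat)
    (f' : hom A' A'') (f : hom A A') (g' : hom B' B'') (g : hom B B'),
    tensm (f' ∘ f) (g' ∘ g) = tensm f' g' ∘ tensm f g;
  tensA : forall A B C, tens (tens A B) C = tens A (tens B C);
  tens1o : forall A, tens unit_ob A = A;
  tenso1 : forall A, tens A unit_ob = A;
  tensmA : forall (A B C A' B' C' : sm_cat)
    (f : hom A A') (g : hom B B') (h : hom C C'),
    eq_hom (tensA A' B' C') ∘ tensm (tensm f g) h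
    = tensm f (tensm g h) ∘ eq_hom (tensA A B C);
  tensm1l : forall (A B : sm_cat) (f : hom A B),
    eq_hom (tens1o B) ∘ tensm (idm unit_ob) f = f ∘ eq_hom (tens1o A);
  tensm1r : forall (A B : sm_cat) (f : hom A B),
    eq_hom (tenso1 B) ∘ tensm f (idm unit_ob) = f ∘ eq_hom (tenso1 A)
}.
Arguments tens {s} A B.
Arguments unit_ob {s}.
Arguments tensm {s A B A' B'} f g.
Arguments tensA {s} A B C.
Arguments tens1o {s} A.
Arguments tenso1 {s} A.
Notation "A ⊗ B" := (tens A B) : cat_scope.
Notation "f ⊠ g" := (tensm f g) : cat_scope.

Section StrictIdentities.
Variable C : strict_monoidal_category.

Definition asso (X Y Z : C) : hom ((X ⊗ Y) ⊗ Z) (X ⊗ (Y ⊗ Z)) :=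
  eq_hom (tensA X Y Z).
Definition assoV (X Y Z : C) : hom (X ⊗ (Y ⊗ Z)) ((X ⊗ Y) ⊗ Z) :=
  eq_hom (eq_sym (tensA X Y Z)).
Definition lunit (X : C) : hom (unit_ob ⊗ X) X := eq_hom (tens1o X).
Definition lunitV (X : C) : hom X (unit_ob ⊗ X) := eq_hom (eq_sym (tens1o X)).
Definition runit (X : C) : hom (X ⊗ unit_ob) X := eq_hom (tenso1 X).
Definition runitV (X : C) : hom X (X ⊗ unit_ob) := eq_hom (eq_sym (tenso1 X)).

End StrictIdentities.

Record strict_braided_category := StrictBraidedCategory {
  sb_cat :> strict_monoidal_category;
  braid : forall A B : sb_cat, hom (A ⊗ B) (B ⊗ A);
  braid_iso : forall A B, is_iso (braid A B);
  braid_nat : forall (A B A' B' : sb_cat) (f : hom A A') (g : hom B B'),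
    braid A' B' ∘ (f ⊠ g) = (g ⊠ f) ∘ braid A B;
  braid_hexr : forall A B C : sb_cat,
    braid A (B ⊗ C)
    = assoV B C A ∘ (idm B ⊠ braid A C) ∘ asso B A C
        ∘ (braid A B ⊠ idm C) ∘ assoV A B C;
  braid_hexl : forall A B C : sb_cat,
    braid (A ⊗ B) C
    = asso C A B ∘ (braid A C ⊠ idm B) ∘ assoV A C B
        ∘ (idm A ⊠ braid B C) ∘ asso A B C
}.
Arguments braid {s} A B.

(** * Hopf algebras *)

Section HopfAlgebras.
Variable C : strict_braided_category.

(* X ⊗ c_{Y,Z} ⊗ T *)
Definition middle_swap (X Y Z T : C) :
  hom ((X ⊗ Y) ⊗ (Z ⊗ T)) ((X ⊗ Z) ⊗ (Y ⊗ T)) :=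
  assoV X Z (Y ⊗ T)
    ∘ (idm X ⊠ (asso Z Y T ∘ (braid Y Z ⊠ idm T) ∘ assoV Y Z T))
    ∘ asso X Y (Z ⊗ T).

Record algebra_on (A : C) := AlgebraOn {
  eta : hom unit_ob A;
  mu : hom (A ⊗ A) A;
  mu_assoc : mu ∘ (mu ⊠ idm A) = mu ∘ (idm A ⊠ mu) ∘ asso A A A;
  mu_unitl : mu ∘ (eta ⊠ idm A) = lunit A;
  mu_unitr : mu ∘ (idm A ⊠ eta) = runit A
}.

Record coalgebra_on (D : C) := CoalgebraOn {
  eps : hom D unit_ob;
  delta : hom D (D ⊗ D);
  delta_coassoc :
    asso D D D ∘ (delta ⊠ idm D) ∘ delta = (idm D ⊠ delta) ∘ delta;
  delta_counitl : (eps ⊠ idm D) ∘ delta = lunitV D;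
  delta_counitr : (idm D ⊠ eps) ∘ delta = runitV D
}.

Definition algebra_morphism (A B : C) (a : algebra_on A) (b : algebra_on B)
  (f : hom A B) : Prop :=
  f ∘ eta a = eta b /\ f ∘ mu a = mu b ∘ (f ⊠ f).

(* Stated for raw counits and coproducts, so that it also applies to the unit
   object and to tensor products of coalgebras. *)
Definition preserves_coalgebra (D E : C)
  (epsD : hom D unit_ob) (deltaD : hom D (D ⊗ D))
  (epsE : hom E unit_ob) (deltaE : hom E (E ⊗ E)) (f : hom D E) : Prop :=
  epsE ∘ f = epsD /\ deltaE ∘ f = (f ⊠ f) ∘ deltaD.

Definition coalgebra_morphism (D E : C)
  (d : coalgebra_on D) (e : coalgebra_on E) (f : hom D E) : Prop :=
  preserves_coalgebra (eps d) (delta d) (eps e) (delta e) f.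

Definition eps_unit : hom unit_ob (unit_ob : C) := idm unit_ob.
Definition delta_unit : hom (unit_ob : C) (unit_ob ⊗ unit_ob) := lunitV unit_ob.

Definition eps_tens (D E : C) (d : coalgebra_on D) (e : coalgebra_on E) :
  hom (D ⊗ E) unit_ob := lunit unit_ob ∘ (eps d ⊠ eps e).
Definition delta_tens (D E : C) (d : coalgebra_on D) (e : coalgebra_on E) :
  hom (D ⊗ E) ((D ⊗ E) ⊗ (D ⊗ E)) :=
  middle_swap D D E E ∘ (delta d ⊠ delta e).

Definition cocommutative (D : C) (d : coalgebra_on D) : Prop :=
  braid D D ∘ delta d = delta d.

Record hopf_on (H : C) (d : coalgebra_on H) := HopfOn {
  hopf_alg :> algebra_on H;
  eta_coalg :
    preserves_coalgebra eps_unit delta_unit (eps d) (delta d) (eta hopf_alg);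
  mu_coalg :
    preserves_coalgebra (eps_tens d d) (delta_tens d d) (eps d) (delta d)
      (mu hopf_alg);
  antipode : hom H H;
  antipoder :
    mu hopf_alg ∘ (idm H ⊠ antipode) ∘ delta d = eta hopf_alg ∘ eps d;
  antipodel :
    mu hopf_alg ∘ (antipode ⊠ idm H) ∘ delta d = eta hopf_alg ∘ eps d
}.

Definition hopf_morphism (H B : C)
  (d : coalgebra_on H) (e : coalgebra_on B) (h : hopf_on d) (b : hopf_on e)
  (f : hom H B) : Prop :=
  algebra_morphism h b f /\ coalgebra_morphism d e f.

Lemma hopf_morphism_id (H : C) (d : coalgebra_on H) (h : hopf_on d) :
  hopf_morphism h h (idm H).
Proof.
repeat split; now rewrite ?tensm1, ?comp1m, ?compm1.
Qed.

Lemma hopf_morphism_comp (H B E : C)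
  (d : coalgebra_on H) (e : coalgebra_on B) (k : coalgebra_on E)
  (h : hopf_on d) (b : hopf_on e) (l : hopf_on k)
  (g : hom B E) (f : hom H B) :
  hopf_morphism b l g -> hopf_morphism h b f -> hopf_morphism h l (g ∘ f).
Proof.
intros [[g1 g2] [g3 g4]] [[f1 f2] [f3 f4]]; repeat split.
- now rewrite <- compA, f1.
- now rewrite <- compA, f2, compA, g2, <- compA, tensmM.
- now rewrite compA, g3.
- now rewrite compA, g4, <- compA, f4, compA, tensmM.
Qed.

End HopfAlgebras.

Arguments eta {C A} _.
Arguments mu {C A} _.
Arguments eps {C D} _.
Arguments delta {C D} _.
Arguments antipode {C H d} _.

Lemma sig_hom_eq (T : Type) (P : T -> Prop) (u v : {x : T | P x}) :
  proj1_sig u = proj1_sig v -> u = v.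
Proof. apply eq_sig_hprop; intros; apply proof_irrelevance. Qed.

(** * Hopf braces *)

Section HopfBraces.
Variable C : strict_braided_category.

Definition Gamma (H : C) (d : coalgebra_on H) (h1 h2 : hopf_on d) :
  hom (H ⊗ H) H :=
  mu h1 ∘ (antipode h1 ⊠ mu h2) ∘ asso H H H ∘ (delta d ⊠ idm H).

Record hopf_brace := HopfBrace {
  hb_ob :> C;
  hb_coalg : coalgebra_on hb_ob;
  hb1 : hopf_on hb_coalg;
  hb2 : hopf_on hb_coalg;
  hb_compat :
    mu hb2 ∘ (idm hb_ob ⊠ mu hb1)
    = mu hb1 ∘ (mu hb2 ⊠ Gamma hb1 hb2)
        ∘ middle_swap hb_ob hb_ob hb_ob hb_ob
        ∘ (delta hb_coalg ⊠ idm (hb_ob ⊗ hb_ob))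
}.

Definition hopf_brace_morphism (H B : hopf_brace) (f : hom H B) : Prop :=
  hopf_morphism (hb1 H) (hb1 B) f /\ hopf_morphism (hb2 H) (hb2 B) f.

Definition HBr_hom (H B : hopf_brace) : Type :=
  {f : hom H B | hopf_brace_morphism f}.

Definition HBr_id (H : hopf_brace) : HBr_hom H H :=
  exist _ (idm (hb_ob H))
    (conj (hopf_morphism_id (hb1 H)) (hopf_morphism_id (hb2 H))).

Definition HBr_comp (H B E : hopf_brace) (g : HBr_hom B E) (f : HBr_hom H B) :
  HBr_hom H E :=
  exist _ (proj1_sig g ∘ proj1_sig f)
    (conj (hopf_morphism_comp (proj1 (proj2_sig g)) (proj1 (proj2_sig f)))
          (hopf_morphism_comp (proj2 (proj2_sig g)) (proj2 (proj2_sig f)))).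

Definition HBr : category :=
  @Category hopf_brace HBr_hom HBr_id HBr_comp
    (fun H B f => sig_hom_eq (u := HBr_comp (HBr_id B) f) (comp1m (proj1_sig f)))
    (fun H B f => sig_hom_eq (u := HBr_comp f (HBr_id H)) (compm1 (proj1_sig f)))
    (fun H B E X h g f =>
       sig_hom_eq (u := HBr_comp h (HBr_comp g f))
         (v := HBr_comp (HBr_comp h g) f)
         (compA (proj1_sig h) (proj1_sig g) (proj1_sig f))).

Definition cocHBr : category :=
  full_subcategory (C := HBr) (fun H : hopf_brace => cocommutative (hb_coalg H)).

End HopfBraces.

(** * Brace triples *)

Section BraceTriples.
Variable C : strict_braided_category.

Record brace_triple := BraceTriple {
  bt_ob :> C;
  bt_coalg : coalgebra_on bt_ob;
  bt_hopf : hopf_on bt_coalg;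
  bt_gamma : hom (bt_ob ⊗ bt_ob) bt_ob;
  bt_T : hom bt_ob bt_ob;
  bt_antipode_iso : is_iso (antipode bt_hopf);
  bt_i :
    (bt_gamma ⊠ idm bt_ob) ∘ assoV bt_ob bt_ob bt_ob
      ∘ (idm bt_ob ⊠ braid bt_ob bt_ob) ∘ asso bt_ob bt_ob bt_ob
      ∘ (delta bt_coalg ⊠ idm bt_ob)
    = (bt_gamma ⊠ idm bt_ob) ∘ assoV bt_ob bt_ob bt_ob
      ∘ (idm bt_ob ⊠ braid bt_ob bt_ob) ∘ asso bt_ob bt_ob bt_ob
      ∘ ((braid bt_ob bt_ob ∘ delta bt_coalg) ⊠ idm bt_ob);
  bt_ii :
    preserves_coalgebra (eps_tens bt_coalg bt_coalg)
      (delta_tens bt_coalg bt_coalg) (eps bt_coalg) (delta bt_coalg) bt_gamma;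
  bt_iii :
    bt_gamma ∘ (idm bt_ob ⊠ mu bt_hopf)
    = mu bt_hopf ∘ (bt_gamma ⊠ bt_gamma)
        ∘ middle_swap bt_ob bt_ob bt_ob bt_ob
        ∘ (delta bt_coalg ⊠ idm (bt_ob ⊗ bt_ob));
  bt_iv :
    bt_gamma ∘ (idm bt_ob ⊠ bt_gamma)
    = bt_gamma
        ∘ ((mu bt_hopf ∘ (idm bt_ob ⊠ bt_gamma) ∘ asso bt_ob bt_ob bt_ob
              ∘ (delta bt_coalg ⊠ idm bt_ob)) ⊠ idm bt_ob)
        ∘ assoV bt_ob bt_ob bt_ob;
  bt_v : bt_gamma ∘ (eta bt_hopf ⊠ idm bt_ob) = lunit bt_ob;
  bt_vi : is_iso bt_T;
  bt_vi1 :
    delta bt_coalg ∘ bt_T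
    = braid bt_ob bt_ob ∘ (bt_T ⊠ bt_T) ∘ delta bt_coalg;
  bt_vi2 : eps bt_coalg ∘ bt_T = eps bt_coalg;
  bt_vi3 :
    mu bt_hopf ∘ (idm bt_ob ⊠ bt_gamma) ∘ asso bt_ob bt_ob bt_ob
      ∘ ((delta bt_coalg ∘ bt_T) ⊠ idm bt_ob)
    = mu bt_hopf ∘ (idm bt_ob ⊠ bt_gamma) ∘ asso bt_ob bt_ob bt_ob
      ∘ (((bt_T ⊠ bt_T) ∘ delta bt_coalg) ⊠ idm bt_ob);
  bt_vi4 :
    bt_gamma ∘ (idm bt_ob ⊠ bt_T) ∘ delta bt_coalg = antipode bt_hopf;
  (* the inverse of the antipode is unique and exists by [bt_antipode_iso] *)
  bt_vi5 : forall antipodeV : hom bt_ob bt_ob,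
    is_inverse (antipode bt_hopf) antipodeV ->
    bt_gamma ∘ (bt_T ⊠ idm bt_ob) ∘ delta bt_coalg = antipodeV ∘ bt_T
}.

Definition brace_triple_morphism (H B : brace_triple) (f : hom H B) : Prop :=
  hopf_morphism (bt_hopf H) (bt_hopf B) f /\
  f ∘ bt_gamma H = bt_gamma B ∘ (f ⊠ f).

Lemma brace_triple_morphism_id (H : brace_triple) :
  brace_triple_morphism (H := H) (B := H) (idm (bt_ob H)).
Proof.
split; [apply hopf_morphism_id|now rewrite tensm1, comp1m, compm1].
Qed.

Lemma brace_triple_morphism_comp (H B E : brace_triple)
  (g : hom B E) (f : hom H B) :
  brace_triple_morphism g -> brace_triple_morphism f ->
  brace_triple_morphism (g ∘ f).
Proof.
intros [g1 g2] [f1 f2]; split; [exact (hopf_morphism_comp g1 f1)|].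
now rewrite <- compA, f2, compA, g2, <- compA, tensmM.
Qed.

Definition BT_hom (H B : brace_triple) : Type :=
  {f : hom H B | brace_triple_morphism f}.

Definition BT_id (H : brace_triple) : BT_hom H H :=
  exist _ (idm (bt_ob H)) (brace_triple_morphism_id H).

Definition BT_comp (H B E : brace_triple) (g : BT_hom B E) (f : BT_hom H B) :
  BT_hom H E :=
  exist _ (proj1_sig g ∘ proj1_sig f)
    (brace_triple_morphism_comp (proj2_sig g) (proj2_sig f)).

Definition BT : category :=
  @Category brace_triple BT_hom BT_id BT_comp
    (fun H B f => sig_hom_eq (u := BT_comp (BT_id B) f) (comp1m (proj1_sig f)))
    (fun H B f => sig_hom_eq (u := BT_comp f (BT_id H)) (compm1 (proj1_sig f)))
    (fun H B E X h g f =>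
       sig_hom_eq (u := BT_comp h (BT_comp g f))
         (v := BT_comp (BT_comp h g) f)
         (compA (proj1_sig h) (proj1_sig g) (proj1_sig f))).

Definition cocBT : category :=
  full_subcategory (C := BT)
    (fun H : brace_triple => cocommutative (bt_coalg H)).

End BraceTriples.

(* Main.v *)
(** By Schauenburg's argument, a cocommutative Hopf algebra satisfies
c_{H,H}^2 = id: cocommutativity makes it a bialgebra for the inverse braiding
as well, and the antipode recovers the braiding from the product and the
coproduct.  Hence H ⊗ H and H ⊗ H ⊗ H are cocommutative coalgebras, on which
⟨f,g⟩ = (f ⊗ g) ∘ δ behaves like a cartesian pairing of coalgebra morphisms.
By a Yoneda argument it is enough to check all identities on coalgebra
morphisms D -> H with D cocommutative, which form a group under convolution;
there a Hopf brace is a skew brace with group operations · and ∘, and the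
correspondence is f ▷ g = f^{-1} · (f ∘ g), f ∘ g = f · (f ▷ g), with T the
antipode of the second structure. *)
Require Import Defs.
From Stdlib Require Import ProofIrrelevance FunctionalExtensionality ClassicalEpsilon.

Set Implicit Arguments.
Unset Strict Implicit.
Unset Printing Implicit Defensive.

(** * Coherence *)

Section EqHom.
Variable C : category.

Lemma eq_hom_id (A : C) (e : A = A) : eq_hom e = idm A.
Proof. now rewrite (proof_irrelevance _ e eq_refl). Qed.

Lemma eq_hom_symK (A B : C) (e : A = B) : eq_hom (eq_sym e) ∘ eq_hom e = idm A.
Proof. destruct e; apply comp1m. Qed.

Lemma eq_homK (A B : C) (e : A = B) : eq_hom e ∘ eq_hom (eq_sym e) = idm B.
Proof. destruct e; apply comp1m. Qed.

Lemma eq_hom_comp (A B D : C) (e' : B = D) (e : A = B) :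
  eq_hom e' ∘ eq_hom e = eq_hom (eq_trans e e').
Proof. destruct e'; apply comp1m. Qed.

Lemma comp_eq_hom2 (A B D E : C) (f : hom D E) (e' : B = D) (e : A = B) :
  f ∘ eq_hom e' ∘ eq_hom e = f ∘ eq_hom (eq_trans e e').
Proof. now rewrite <- compA, eq_hom_comp. Qed.

End EqHom.

(** * Morphisms up to equality of endpoints *)

Section Arrows.
Variable C : strict_monoidal_category.

(* Arrows up to equality of their endpoints: on these the tensor is strictly
   associative and unital, and composition is partial ([None]: not composable). *)
Definition arrow : Type := option {A : C & {B : C & hom A B}}.

Definition pack (A B : C) (f : hom A B) : arrow :=
  Some (existT _ A (existT _ B f)).

Definition acomp (u v : arrow) : arrow :=
  match u, v with
  | Some (existT _ B' (existT _ D g)), Some (existT _ A (existT _ B f)) =>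
    match excluded_middle_informative (B = B') with
    | left e => pack (g ∘ eq_hom e ∘ f)
    | right _ => None
    end
  | _, _ => None
  end.

Definition atens (u v : arrow) : arrow :=
  match u, v with
  | Some (existT _ A (existT _ B f)), Some (existT _ A' (existT _ B' g)) =>
    pack (f ⊠ g)
  | _, _ => None
  end.

Infix "•" := acomp (at level 42, right associativity).
Infix "⊙" := atens (at level 39, right associativity).
Notation I A := (pack (idm A)).

Lemma pack_inj (A B : C) (f g : hom A B) : pack f = pack g -> f = g.
Proof.
intros e; injection e; intros e'; now apply inj_pair2, inj_pair2 in e'.
Qed.

(** Turns the naturality squares by which strictness on morphisms is axiomatized into plain
    equalities of arrows. *)
Lemma pack_eq (A B A' B' : C) (f : hom A B) (g : hom A' B')
  (eA : A = A') (eB : B = B') :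
  eq_hom eB ∘ f = g ∘ eq_hom eA -> pack f = pack g.
Proof.
destruct eA, eB; simpl; rewrite comp1m, compm1; now intros ->.
Qed.

Lemma pack_comp (A B D : C) (g : hom B D) (f : hom A B) :
  pack (g ∘ f) = pack g • pack f.
Proof.
simpl; destruct excluded_middle_informative as [e|n]; [|now destruct n].
now rewrite eq_hom_id, compm1.
Qed.

Lemma pack_tens (A B A' B' : C) (f : hom A B) (g : hom A' B') :
  pack (f ⊠ g) = pack f ⊙ pack g.
Proof. reflexivity. Qed.

Lemma acompA (u v w : arrow) : (u • v) • w = u • (v • w).
Proof.
destruct u as [[A [B f]]|], v as [[A' [B' g]]|], w as [[A'' [B'' h]]|];
  simpl; try reflexivity; repeat
  (destruct excluded_middle_informative; simpl; try congruence).
- subst; simpl; now rewrite !compm1, !compA, !eq_hom_id, !compm1.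
Qed.

Lemma atensA (u v w : arrow) : (u ⊙ v) ⊙ w = u ⊙ (v ⊙ w).
Proof.
destruct u as [[A [B f]]|], v as [[A' [B' g]]|], w as [[A'' [B'' h]]|];
  try reflexivity.
simpl; apply pack_eq with (tensA _ _ _) (tensA _ _ _), tensmA.
Qed.

Lemma atens1l (u : arrow) : I unit_ob ⊙ u = u.
Proof.
destruct u as [[A [B f]]|]; [|reflexivity].
simpl; apply pack_eq with (tens1o _) (tens1o _), tensm1l.
Qed.

Lemma atens1r (u : arrow) : u ⊙ I unit_ob = u.
Proof.
destruct u as [[A [B f]]|]; [|reflexivity].
simpl; apply pack_eq with (tenso1 _) (tenso1 _), tensm1r.
Qed.

Lemma pack_idtens (A B : C) : I (A ⊗ B) = I A ⊙ I B.
Proof. simpl; now rewrite tensm1. Qed.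

Lemma pack_eqhom (A B : C) (e : A = B) : pack (eq_hom e) = I A.
Proof. now destruct e. Qed.

Lemma pack_ecomp (A B D : C) (e : B = D) (f : hom A B) :
  pack (eq_hom e ∘ f) = pack f.
Proof. destruct e; simpl; now rewrite comp1m. Qed.

Lemma pack_compe (A B D : C) (e : A = B) (f : hom B D) :
  pack (f ∘ eq_hom e) = pack f.
Proof. destruct e; simpl; now rewrite compm1. Qed.

Lemma pack_id_comp (A B : C) (f : hom A B) : I B • pack f = pack f.
Proof. now rewrite <- pack_comp, comp1m. Qed.

Lemma pack_comp_id (A B : C) (f : hom A B) : pack f • I A = pack f.
Proof. now rewrite <- pack_comp, compm1. Qed.

Lemma tens_compl (A B D X : C) (g : hom B D) (f : hom A B) :
  (g ∘ f) ⊠ idm X = (g ⊠ idm X) ∘ (f ⊠ idm X).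
Proof. now rewrite <- tensmM, comp1m. Qed.

Lemma tens_compr (A B D X : C) (g : hom B D) (f : hom A B) :
  idm X ⊠ (g ∘ f) = (idm X ⊠ g) ∘ (idm X ⊠ f).
Proof. now rewrite <- tensmM, comp1m. Qed.

Lemma eqhom_tensl (A B X : C) (e : A = B) :
  eq_hom e ⊠ idm X = eq_hom (f_equal (fun Y => Y ⊗ X) e).
Proof. destruct e; apply tensm1. Qed.

Lemma eqhom_tensr (A B X : C) (e : A = B) :
  idm X ⊠ eq_hom e = eq_hom (f_equal (fun Y => X ⊗ Y) e).
Proof. destruct e; apply tensm1. Qed.

Lemma eq_hom_tens (A B A' B' : C) (e : A = B) (e' : A' = B') :
  eq_hom e ⊠ eq_hom e' = eq_hom (f_equal2 tens e e').
Proof. destruct e, e'; rewrite !eq_hom_id; apply tensm1. Qed.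

End Arrows.

Infix "•" := acomp (at level 42, right associativity).
Infix "⊙" := atens (at level 39, right associativity).
Notation I A := (pack (idm A)).

(* Turns a packed composite into a word of slices [I X ⊙ pack f ⊙ I Y], without
   associators and unitors. *)
Ltac strictify :=
  unfold middle_swap, asso, assoV, lunit, lunitV, runit, runitV;
  repeat progress (rewrite ?tens_compl, ?tens_compr, ?eqhom_tensl, ?eqhom_tensr,
    ?eq_hom_tens);
  rewrite ?compA, ?eq_hom_comp, ?comp_eq_hom2;
  repeat first [rewrite pack_compe | rewrite pack_ecomp | rewrite pack_comp];
  rewrite ?pack_tens, ?pack_eqhom, ?pack_idtens, ?atensA, ?atens1l, ?atens1r,
    ?acompA.

(** * Word identities for the braiding *)

Section Coherence.
Variable C : strict_braided_category.
Notation "'c' A B" := (pack (braid A B)) (at level 9, A at level 8, B at level 8).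

Lemma pack_braid_hexr (A B D : C) :
  c A (B ⊗ D) = (I B ⊙ c A D) • (c A B ⊙ I D).
Proof. now rewrite braid_hexr; strictify. Qed.

Lemma pack_braid_hexl (A B D : C) :
  c (A ⊗ B) D = (c A D ⊙ I B) • (I A ⊙ c B D).
Proof. now rewrite braid_hexl; strictify. Qed.

Lemma idempotent_iso (A : C) (f : hom A A) : is_iso f -> f ∘ f = f -> f = idm A.
Proof.
intros [g [gf fg]] ff.
transitivity (g ∘ f ∘ f); [now rewrite gf, comp1m|now rewrite <- compA, ff].
Qed.

(** Since K ⊗ K = K, the hexagon for c_{A,K⊗K} makes c_{A,K} idempotent, and an invertible
    idempotent is an identity. The map [f] is this braiding read as an endomorphism of A, so that
    idempotence makes sense. *)
Lemma pack_braid_unitr (A : C) : c A unit_ob = I A.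
Proof.
set (f := eq_hom (tens1o A) ∘ braid A unit_ob ∘ eq_hom (eq_sym (tenso1 A))).
assert (ef : pack f = c A unit_ob).
{ now unfold f; rewrite pack_compe, pack_ecomp. }
assert (eK : c A (unit_ob ⊗ unit_ob) = c A unit_ob) by now rewrite tens1o.
rewrite <- ef; f_equal; apply idempotent_iso.
- destruct (braid_iso A (unit_ob : C)) as [g [gf fg]].
  exists (eq_hom (tenso1 A) ∘ g ∘ eq_hom (eq_sym (tens1o A))); split; unfold f;
    apply pack_inj; rewrite !compA.
  + rewrite <- (compA _ (eq_hom _) (eq_hom _)), eq_hom_symK, compm1.
    rewrite <- (compA _ g _), gf.
    now rewrite pack_compe, compm1, pack_eqhom, tenso1.
  + rewrite <- (compA _ (eq_hom _) (eq_hom _)), eq_hom_symK, compm1.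
    rewrite <- (compA _ (braid _ _) _), fg.
    now rewrite pack_compe, compm1, pack_eqhom, tens1o.
- apply pack_inj; rewrite pack_comp, ef; etransitivity; [|exact eK].
  now rewrite pack_braid_hexr, atens1l, atens1r.
Qed.

Lemma pack_braid_unitl (A : C) : c unit_ob A = I A.
Proof.
set (f := eq_hom (tenso1 A) ∘ braid unit_ob A ∘ eq_hom (eq_sym (tens1o A))).
assert (ef : pack f = c unit_ob A).
{ now unfold f; rewrite pack_compe, pack_ecomp. }
assert (eK : c (unit_ob ⊗ unit_ob) A = c unit_ob A) by now rewrite tens1o.
rewrite <- ef; f_equal; apply idempotent_iso.
- destruct (braid_iso (unit_ob : C) A) as [g [gf fg]].
  exists (eq_hom (tens1o A) ∘ g ∘ eq_hom (eq_sym (tenso1 A))); split; unfold f;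
    apply pack_inj; rewrite !compA.
  + rewrite <- (compA _ (eq_hom _) (eq_hom _)), eq_hom_symK, compm1.
    rewrite <- (compA _ g _), gf.
    now rewrite pack_compe, compm1, pack_eqhom, tens1o.
  + rewrite <- (compA _ (eq_hom _) (eq_hom _)), eq_hom_symK, compm1.
    rewrite <- (compA _ (braid _ _) _), fg.
    now rewrite pack_compe, compm1, pack_eqhom, tenso1.
- apply pack_inj; rewrite pack_comp, ef; etransitivity; [|exact eK].
  now rewrite pack_braid_hexl, atens1l, atens1r.
Qed.

(** Generalizes [middle_swap] to an arbitrary crossing [s], so that the inverse braiding or an
    unknown morphism can take the place of c. *)
Definition middle (X T Y Z Z' Y' : C) (s : hom (Y ⊗ Z) (Z' ⊗ Y')) :
  hom ((X ⊗ Y) ⊗ (Z ⊗ T)) ((X ⊗ Z') ⊗ (Y' ⊗ T)) :=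
  assoV X Z' (Y' ⊗ T)
    ∘ (idm X ⊠ (asso Z' Y' T ∘ (s ⊠ idm T) ∘ assoV Y Z T))
    ∘ asso X Y (Z ⊗ T).

Lemma pack_middle (X T Y Z Z' Y' : C) (s : hom (Y ⊗ Z) (Z' ⊗ Y')) :
  pack (middle X T s) = I X ⊙ pack s ⊙ I T.
Proof. now unfold middle; strictify. Qed.

Lemma pack_middle_pre (X T Y Z Z' Y' X0 T0 Y0 Z0 : C)
  (s : hom (Y ⊗ Z) (Z' ⊗ Y')) (f : hom X0 X) (g : hom Y0 Y) (h : hom Z0 Z)
  (k : hom T0 T) :
  pack (middle X T s ∘ ((f ⊠ g) ⊠ (h ⊠ k)))
  = pack f ⊙ pack (s ∘ (g ⊠ h)) ⊙ pack k.
Proof.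
rewrite pack_comp, pack_middle, !pack_tens, !atensA.
rewrite <- (atensA (pack g)), <- !pack_tens, <- pack_comp.
now rewrite <- !tensmM, !comp1m.
Qed.

Lemma pack_middle_post (X T Y Z Z' Y' X0 T0 Y0 Z0 : C)
  (s : hom (Y ⊗ Z) (Z' ⊗ Y')) (f : hom X X0) (g : hom Y' Y0) (h : hom Z' Z0)
  (k : hom T T0) :
  pack (((f ⊠ h) ⊠ (g ⊠ k)) ∘ middle X T s)
  = pack f ⊙ pack ((h ⊠ g) ∘ s) ⊙ pack k.
Proof.
rewrite pack_comp, pack_middle, !pack_tens, !atensA.
rewrite <- (atensA (pack h)), <- !pack_tens, <- pack_comp.
now rewrite <- !tensmM, !compm1.
Qed.

Lemma middle_nat (X T Y Z Z' Y' X0 T0 Y0 Z0 Z0' Y0' : C)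
  (s : hom (Y ⊗ Z) (Z' ⊗ Y')) (s0 : hom (Y0 ⊗ Z0) (Z0' ⊗ Y0'))
  (f : hom X0 X) (g : hom Y0 Y) (h : hom Z0 Z) (k : hom T0 T)
  (g' : hom Y0' Y') (h' : hom Z0' Z') :
  s ∘ (g ⊠ h) = (h' ⊠ g') ∘ s0 ->
  middle X T s ∘ ((f ⊠ g) ⊠ (h ⊠ k)) = ((f ⊠ h') ⊠ (g' ⊠ k)) ∘ middle X0 T0 s0.
Proof. intros e; apply pack_inj; now rewrite pack_middle_pre, pack_middle_post, e. Qed.

Lemma middle_swap_nat (X Y Z T X0 Y0 Z0 T0 : C)
  (f : hom X0 X) (g : hom Y0 Y) (h : hom Z0 Z) (k : hom T0 T) :
  middle_swap X Y Z T ∘ ((f ⊠ g) ⊠ (h ⊠ k))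
  = ((f ⊠ h) ⊠ (g ⊠ k)) ∘ middle_swap X0 Y0 Z0 T0.
Proof. apply middle_nat, braid_nat. Qed.

Lemma middle_id (X Y Z T : C) :
  middle X T (idm (Y ⊗ Z)) = idm ((X ⊗ Y) ⊗ (Z ⊗ T)).
Proof.
apply pack_inj; now rewrite pack_middle, !pack_idtens, !atensA.
Qed.

Lemma middle_comp (X T Y Z Z' Y' Z'' Y'' : C)
  (s' : hom (Z' ⊗ Y') (Z'' ⊗ Y'')) (s : hom (Y ⊗ Z) (Z' ⊗ Y')) :
  middle X T s' ∘ middle X T s = middle X T (s' ∘ s).
Proof.
apply pack_inj; rewrite pack_comp, !pack_middle.
now rewrite <- !pack_tens, <- pack_comp, <- !tensmM, !comp1m.
Qed.

Lemma pack_exchange (L A A' B B' R : C) (f : hom A A') (g : hom B B') :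
  (I L ⊙ I A' ⊙ pack g ⊙ I R) • (I L ⊙ pack f ⊙ I B ⊙ I R)
  = (I L ⊙ pack f ⊙ I B' ⊙ I R) • (I L ⊙ I A ⊙ pack g ⊙ I R).
Proof.
now rewrite <- !pack_tens, <- !pack_comp, <- !tensmM, !comp1m, !compm1.
Qed.

(** After the hexagons both sides are words in c_{X'',Y}, c_{X',Y} and c_{X'',Y'}; they differ only
    in the order of the last two, which act on disjoint strands. *)
Lemma middle_swap_assoc (X X' X'' Y Y' Y'' : C) :
  asso _ _ _ ∘ (middle_swap X X' Y Y' ⊠ idm (X'' ⊗ Y''))
    ∘ middle_swap (X ⊗ X') X'' (Y ⊗ Y') Y''
  = (idm (X ⊗ Y) ⊠ middle_swap X' X'' Y' Y'')
    ∘ middle_swap X (X' ⊗ X'') Y (Y' ⊗ Y'')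
    ∘ (asso X X' X'' ⊠ asso Y Y' Y'').
Proof.
apply pack_inj; unfold middle_swap; rewrite braid_hexr, (braid_hexl X').
strictify.
pose proof (pack_exchange X Y'' (braid X' Y) (braid X'' Y')) as e.
rewrite !pack_idtens, !atensA in e.
now rewrite <- !acompA, e.
Qed.

Lemma pack_id_tens (A B A' B' : C) (f : hom A A') (g : hom B B') :
  (pack f ⊙ I B') • (I A ⊙ pack g) = pack f ⊙ pack g.
Proof. now rewrite <- !pack_tens, <- pack_comp, <- tensmM, comp1m, compm1. Qed.

Lemma pack_tens_id (A B A' B' : C) (f : hom A A') (g : hom B B') :
  (I A' ⊙ pack g) • (pack f ⊙ I B) = pack f ⊙ pack g.
Proof. now rewrite <- !pack_tens, <- pack_comp, <- tensmM, comp1m, compm1. Qed.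

Lemma pack_slide (A B A' B' : C) (f : hom A A') (g : hom B B') :
  (I A' ⊙ pack g) • (pack f ⊙ I B) = (pack f ⊙ I B') • (I A ⊙ pack g).
Proof. now rewrite pack_tens_id, pack_id_tens. Qed.

Lemma braid_tens_tens (X Y Z T : C) :
  braid (X ⊗ Y) (Z ⊗ T)
  = middle_swap Z X T Y ∘ (braid X Z ⊠ braid Y T) ∘ middle_swap X Y Z T.
Proof.
apply pack_inj; rewrite braid_hexl.
unfold middle_swap; rewrite braid_hexr, (braid_hexr Y Z T).
strictify.
rewrite <- (pack_id_tens (braid X Z) (braid Y T)).
now rewrite !pack_idtens, !atensA, !acompA.
Qed.

(** By the hexagons the double braiding of X with Y ⊗ Z contains the one with Z inside the one with
    Y, and the two cancel in turn. This carries c² = id from H to H ⊗ H. *)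
Lemma braid_sym_tens (X Y Z : C) :
  braid Y X ∘ braid X Y = idm (X ⊗ Y) -> braid Z X ∘ braid X Z = idm (X ⊗ Z) ->
  braid (Y ⊗ Z) X ∘ braid X (Y ⊗ Z) = idm (X ⊗ (Y ⊗ Z)).
Proof.
intros eY eZ; apply pack_inj; rewrite braid_hexl, braid_hexr; strictify.
rewrite <- (acompA (I Y ⊙ _)), <- (pack_tens (idm Y) (braid Z X)),
  <- (pack_tens (idm Y) (braid X Z)), <- pack_comp, <- tensmM, eZ, comp1m.
rewrite pack_tens, pack_idtens, <- (atensA (I Y)), <- (pack_idtens Y X).
rewrite <- !pack_tens, <- !pack_comp, tensm1, comp1m, <- tensmM, eY, comp1m.
now rewrite pack_tens, pack_idtens, atensA.
Qed.

End Coherence.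

(** * Tensor products of coalgebras *)

Section Coalgebras.
Variable C : strict_braided_category.

Definition pair (D X Y : C) (d : coalgebra_on D) (f : hom D X) (g : hom D Y) :
  hom D (X ⊗ Y) := (f ⊠ g) ∘ delta d.

Lemma coalg_tens_coassoc (D E : C) (d : coalgebra_on D) (e : coalgebra_on E) :
  asso (D ⊗ E) (D ⊗ E) (D ⊗ E) ∘ (delta_tens d e ⊠ idm (D ⊗ E))
    ∘ delta_tens d e
  = (idm (D ⊗ E) ⊠ delta_tens d e) ∘ delta_tens d e.
Proof.
unfold delta_tens.
set (m := middle_swap D D E E).
transitivity (asso _ _ _ ∘ (m ⊠ idm (D ⊗ E))
  ∘ ((delta d ⊠ delta e ⊠ (idm D ⊠ idm E)) ∘ m) ∘ (delta d ⊠ delta e)).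
{ now rewrite tensm1, tens_compl, !compA. }
(* Naturality moves the swaps after all coproducts; what remains is coassociativity in each factor
   and [middle_swap_assoc]. *)
unfold m at 2; rewrite <- middle_swap_nat, !compA.
unfold m; rewrite middle_swap_assoc, <- !compA, <- !tensmM.
rewrite !compA, !delta_coassoc, tens_compr, tensmM, <- (tensm1 D E).
fold m; rewrite <- !(compA (idm D ⊠ idm E ⊠ m)).
f_equal; rewrite !compA; f_equal.
apply middle_swap_nat.
Qed.

Lemma coalg_tens_counitl (D E : C) (d : coalgebra_on D) (e : coalgebra_on E) :
  (eps_tens d e ⊠ idm (D ⊗ E)) ∘ delta_tens d e = lunitV (D ⊗ E).
Proof.
unfold eps_tens, delta_tens.
rewrite tens_compl, <- tensm1, <- !compA, (compA _ (middle_swap _ _ _ _)).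
rewrite <- middle_swap_nat, <- compA, <- tensmM, !delta_counitl.
apply pack_inj; unfold middle_swap; strictify.
now rewrite pack_braid_unitr, <- pack_idtens, pack_id_comp.
Qed.

Lemma coalg_tens_counitr (D E : C) (d : coalgebra_on D) (e : coalgebra_on E) :
  (idm (D ⊗ E) ⊠ eps_tens d e) ∘ delta_tens d e = runitV (D ⊗ E).
Proof.
unfold eps_tens, delta_tens.
rewrite tens_compr, <- tensm1, <- !compA, (compA _ (middle_swap _ _ _ _)).
rewrite <- middle_swap_nat, <- compA, <- tensmM, !delta_counitr.
apply pack_inj; unfold middle_swap; strictify.
now rewrite pack_braid_unitl, <- pack_idtens, pack_id_comp.
Qed.
End Coalgebras.

(** * Coalgebra morphisms as generalized points *)

Section Pairing.
Variable C : strict_braided_category.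

Definition coalg_tens (D E : C) (d : coalgebra_on D) (e : coalgebra_on E) :
  coalgebra_on (D ⊗ E) :=
  CoalgebraOn (coalg_tens_coassoc d e) (coalg_tens_counitl d e)
    (coalg_tens_counitr d e).

Lemma lunitK (X : C) : lunit X ∘ lunitV X = idm X.
Proof. apply eq_homK. Qed.

Lemma runitK (X : C) : runit X ∘ runitV X = idm X.
Proof. apply eq_homK. Qed.

Lemma assoVK (X Y Z : C) : assoV X Y Z ∘ asso X Y Z = idm _.
Proof. apply eq_hom_symK. Qed.

Section Points.
Variables (D : C) (d : coalgebra_on D).

Lemma pair_tens (X Y X' Y' : C) (a : hom X X') (b : hom Y Y')
  (f : hom D X) (g : hom D Y) : (a ⊠ b) ∘ pair d f g = pair d (a ∘ f) (b ∘ g).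
Proof. unfold pair; now rewrite compA, <- tensmM. Qed.

Lemma pair_assoc (X Y Z : C) (f : hom D X) (g : hom D Y) (h : hom D Z) :
  asso X Y Z ∘ pair d (pair d f g) h = pair d f (pair d g h).
Proof.
unfold pair.
transitivity ((f ⊠ (g ⊠ h)) ∘ (asso D D D ∘ (delta d ⊠ idm D) ∘ delta d)).
- rewrite !compA; unfold asso at 2; rewrite <- tensmA, <- !compA.
  now rewrite (compA _ (delta d ⊠ _)), <- tensmM, compm1.
- now rewrite delta_coassoc, compA, <- tensmM, compm1.
Qed.

Lemma pair_assocV (X Y Z : C) (f : hom D X) (g : hom D Y) (h : hom D Z) :
  assoV X Y Z ∘ pair d f (pair d g h) = pair d (pair d f g) h.
Proof. now rewrite <- pair_assoc, compA, assoVK, comp1m. Qed.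

Lemma pair_epsl (X : C) (f : hom D X) : lunit X ∘ pair d (eps d) f = f.
Proof.
unfold pair.
transitivity (lunit X ∘ (idm _ ⊠ f) ∘ ((eps d ⊠ idm D) ∘ delta d)).
- now rewrite <- compA, (compA (idm _ ⊠ f)), <- tensmM, comp1m, compm1.
- now rewrite delta_counitl; unfold lunit at 1; rewrite tensm1l, <- compA,
    lunitK, compm1.
Qed.

Lemma pair_epsr (X : C) (f : hom D X) : runit X ∘ pair d f (eps d) = f.
Proof.
unfold pair.
transitivity (runit X ∘ (f ⊠ idm _) ∘ ((idm D ⊠ eps d) ∘ delta d)).
- now rewrite <- compA, (compA (f ⊠ idm _)), <- tensmM, comp1m, compm1.
- now rewrite delta_counitr; unfold runit at 1; rewrite tensm1r, <- compA,
    runitK, compm1.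
Qed.

Lemma pair_comp (D' X Y : C) (d' : coalgebra_on D') (u : hom D' D)
  (f : hom D X) (g : hom D Y) : coalgebra_morphism d' d u ->
  pair d f g ∘ u = pair d' (f ∘ u) (g ∘ u).
Proof.
intros [_ eu]; unfold pair; now rewrite <- compA, eu, compA, <- tensmM.
Qed.

Lemma delta_pair (E : C) (e : coalgebra_on E) (f : hom D E) :
  coalgebra_morphism d e f -> delta e ∘ f = pair d f f.
Proof. now intros [_ ef]. Qed.

Lemma pair_id : pair d (idm D) (idm D) = delta d.
Proof. unfold pair; now rewrite tensm1, comp1m. Qed.

Hypothesis coc : cocommutative d.

Lemma pair_braid (X Y : C) (f : hom D X) (g : hom D Y) :
  braid X Y ∘ pair d f g = pair d g f.
Proof. unfold pair; now rewrite compA, braid_nat, <- compA, coc. Qed.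

(** After reassociation the braiding acts on the inner pair ⟨g,h⟩, which it merely reverses because
    the domain is cocommutative. *)
Lemma pair_middle_swap (X Y Z T : C) (f : hom D X) (g : hom D Y) (h : hom D Z)
  (k : hom D T) :
  middle_swap X Y Z T ∘ pair d (pair d f g) (pair d h k)
  = pair d (pair d f h) (pair d g k).
Proof.
unfold middle_swap; rewrite <- !compA, pair_assoc, pair_tens, <- !compA.
now rewrite pair_assocV, pair_tens, pair_braid, pair_assoc, pair_assocV, !comp1m.
Qed.

Lemma pair_coalg (E E' : C) (e : coalgebra_on E) (e' : coalgebra_on E')
  (f : hom D E) (g : hom D E') :
  coalgebra_morphism d e f -> coalgebra_morphism d e' g ->
  coalgebra_morphism d (coalg_tens e e') (pair d f g).
Proof.
intros Pf Pg; split; simpl.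
- unfold eps_tens; rewrite <- compA, pair_tens, (proj1 Pf), (proj1 Pg).
  apply pair_epsl.
- unfold delta_tens; rewrite <- compA, pair_tens, !delta_pair by assumption.
  now rewrite pair_middle_swap.
Qed.

End Points.

Section Projections.
Variables (D E : C) (d : coalgebra_on D) (e : coalgebra_on E).

Definition proj1m : hom (D ⊗ E) D := runit D ∘ (idm D ⊠ eps e).
Definition proj2m : hom (D ⊗ E) E := lunit E ∘ (eps d ⊠ idm E).

(** Exhibits the identity of D ⊗ E as a generic pair of points, on which identities between
    morphisms can be tested. *)
Lemma pair_proj : pair (coalg_tens d e) proj1m proj2m = idm (D ⊗ E).
Proof.
unfold pair, proj1m, proj2m; simpl; unfold delta_tens.
rewrite tensmM, <- compA, (compA _ (middle_swap _ _ _ _)), <- middle_swap_nat.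
rewrite <- compA, <- tensmM, delta_counitl, delta_counitr.
apply pack_inj; unfold middle_swap; strictify.
now rewrite pack_braid_unitr, atens1l.
Qed.

Lemma eps_eps (X : C) (x : coalgebra_on X) :
  (eps x ⊠ eps x) ∘ delta x = lunitV unit_ob ∘ eps x.
Proof.
rewrite <- (comp1m (eps x)) at 1; rewrite <- (compm1 (eps x)) at 2.
rewrite tensmM, <- compA, delta_counitl.
apply pack_inj; strictify.
reflexivity.
Qed.

Lemma proj1m_coalg : coalgebra_morphism (coalg_tens d e) d proj1m.
Proof.
split; simpl; apply pack_inj.
- unfold proj1m, eps_tens; strictify.
  now rewrite <- (atens1r (pack (eps d))) at 1; rewrite pack_id_tens.
- unfold proj1m, delta_tens.
  rewrite tensmM, !compA, <- (compA (runit D ⊠ _)), <- middle_swap_nat, tensm1.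
  rewrite <- !compA, <- tensmM, comp1m, eps_eps.
  unfold middle_swap; strictify; unfold lunitV.
  rewrite pack_ecomp, pack_braid_unitr.
  rewrite <- (pack_id_tens (delta d) (eps e)), atens1r, <- acompA.
  now rewrite <- pack_idtens, pack_id_comp.
Qed.

Lemma proj2m_coalg : coalgebra_morphism (coalg_tens d e) e proj2m.
Proof.
split; simpl; apply pack_inj.
- unfold proj2m, eps_tens; strictify.
  now rewrite <- (atens1l (pack (eps e))) at 1; rewrite pack_tens_id.
- unfold proj2m, delta_tens.
  rewrite tensmM, !compA, <- (compA (lunit E ⊠ _)), <- middle_swap_nat, tensm1.
  rewrite <- !compA, <- tensmM, comp1m, eps_eps.
  unfold middle_swap; strictify; unfold lunitV.
  rewrite pack_ecomp, pack_braid_unitl.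
  rewrite <- (pack_tens_id (eps d) (delta e)), atens1l, <- acompA.
  now rewrite <- pack_idtens, pack_id_comp.
Qed.

Lemma pair_proj2 (X : C) (x : coalgebra_on X) (f : hom X D) (g : hom X E) :
  eps d ∘ f = eps x -> proj2m ∘ pair x f g = g.
Proof.
intros ef; unfold proj2m.
now rewrite <- compA, pair_tens, comp1m, ef, pair_epsl.
Qed.

Lemma coalg_tens_coc :
  cocommutative d -> cocommutative e ->
  braid E D ∘ braid D E = idm (D ⊗ E) ->
  cocommutative (coalg_tens d e).
Proof.
intros cd ce s; unfold cocommutative; simpl; unfold delta_tens.
(* The braiding of D ⊗ E with itself is c_{D,D} ⊗ c_{E,E} between two middle swaps; the first of
   them meets the swap of the coproduct and cancels by [s]. *)
rewrite braid_tens_tens, compA, <- (compA _ (middle_swap D E D E)).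
unfold middle_swap at 2 3; fold (middle D E (braid E D)) (middle D E (braid D E)).
rewrite middle_comp, s, middle_id, compm1.
now rewrite <- compA, <- tensmM, cd, ce.
Qed.

End Projections.
End Pairing.

(** * The braiding of a cocommutative Hopf algebra *)

Section Schauenburg.
Variables (C : strict_braided_category) (H : C) (d : coalgebra_on H)
  (h : hopf_on d).

(** In elements: h ⊗ x is sent to a(h₁) · f(h₂ ⊗ x), the product taken in the factor H. The mirror
    image [rshear] sends x ⊗ h to f(x ⊗ h₁) · a(h₂). *)
Definition lshear (X Y : C) (a : hom H H) (f : hom (H ⊗ X) (H ⊗ Y)) :
  hom (H ⊗ X) (H ⊗ Y) :=
  (mu h ⊠ idm Y) ∘ assoV H H Y ∘ (idm H ⊠ f) ∘ asso H H X
    ∘ (((a ⊠ idm H) ∘ delta d) ⊠ idm X).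

Definition rshear (X Y : C) (a : hom H H) (f : hom (X ⊗ H) (Y ⊗ H)) :
  hom (X ⊗ H) (Y ⊗ H) :=
  (idm Y ⊠ mu h) ∘ asso Y H H ∘ (f ⊠ idm H) ∘ assoV X H H
    ∘ (idm X ⊠ ((idm H ⊠ a) ∘ delta d)).

(** In elements this is λ(h₁) h₂ f(h₃ ⊗ x) = f(h ⊗ x). Hence shearing by the identity is
    injective. *)
Lemma lshearK (X Y : C) (f : hom (H ⊗ X) (H ⊗ Y)) :
  lshear (antipode h) (lshear (idm H) f) = f.
Proof.
assert (muA : (pack (mu h) ⊙ I Y) • (I H ⊙ pack (mu h) ⊙ I Y)
  = (pack (mu h) ⊙ I Y) • (pack (mu h) ⊙ I H ⊙ I Y)).
{ transitivity (pack ((mu h ∘ (idm H ⊠ mu h) ∘ asso H H H) ⊠ idm Y));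
    [|rewrite <- mu_assoc]; now strictify. }
assert (deltaA : (I H ⊙ pack (delta d) ⊙ I X) • (pack (delta d) ⊙ I X)
  = (pack (delta d) ⊙ I H ⊙ I X) • (pack (delta d) ⊙ I X)).
{ transitivity (pack (((idm H ⊠ delta d) ∘ delta d) ⊠ idm X));
    [|rewrite <- delta_coassoc]; now strictify. }
assert (anti : (pack (mu h) ⊙ I H ⊙ I Y) • (pack (antipode h) ⊙ I H ⊙ I H ⊙ I Y)
    • (pack (delta d) ⊙ I H ⊙ I Y)
  = (pack (eta h) ⊙ I H ⊙ I Y) • (pack (eps d) ⊙ I H ⊙ I Y)).
{ transitivity (pack ((mu h ∘ (antipode h ⊠ idm H) ∘ delta d) ⊠ idm (H ⊗ Y)));
    [|rewrite antipodel]; now strictify. }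
assert (muU : (pack (mu h) ⊙ I Y) • (pack (eta h) ⊙ I H ⊙ I Y) = I (H ⊗ Y)).
{ transitivity (pack ((mu h ∘ (eta h ⊠ idm H)) ⊠ idm Y));
    [|rewrite mu_unitl]; now strictify. }
assert (deltaU : (pack (eps d) ⊙ I H ⊙ I X) • (pack (delta d) ⊙ I X) = I (H ⊗ X)).
{ transitivity (pack (((eps d ⊠ idm H) ∘ delta d) ⊠ idm X));
    [|rewrite delta_counitl]; now strictify. }
(* The slides move factors on disjoint strands past each other: they bring the two coproducts
   together, then the two products, until the antipode law applies and the counit can pass [f]. *)
pose proof (pack_slide (antipode h) (delta d ⊠ idm X)) as s1.
pose proof (pack_slide (antipode h ⊠ idm H) f) as s2.
pose proof (pack_slide (delta d) f) as s3.
pose proof (pack_slide (eps d) f) as s4.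
rewrite !pack_tens, !pack_idtens, !atensA in s1.
rewrite !pack_tens, !pack_idtens, !atensA in s2.
rewrite !pack_idtens, !atensA in s3.
rewrite atens1l, !pack_idtens in s4.
unfold lshear; rewrite tensm1, comp1m; apply pack_inj; strictify.
rewrite <- (acompA (I H ⊙ pack (delta d) ⊙ I X)), s1, !acompA, deltaA.
rewrite <- (acompA (I H ⊙ I H ⊙ pack f)), s2, !acompA.
rewrite <- (acompA (I H ⊙ I H ⊙ pack f)), s3, !acompA.
rewrite <- (acompA (pack (mu h) ⊙ I Y)), muA, !acompA.
rewrite <- (acompA _ _ ((I H ⊙ pack f) • _)), <- (acompA _ _ ((I H ⊙ pack f) • _)).
rewrite anti, acompA, <- (acompA (pack (eps d) ⊙ _)), <- s4, acompA, deltaU.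
now rewrite <- acompA, muU, pack_comp_id, pack_id_comp.
Qed.

Lemma rshearK (X Y : C) (f : hom (X ⊗ H) (Y ⊗ H)) :
  rshear (antipode h) (rshear (idm H) f) = f.
Proof.
assert (muA : (I Y ⊙ pack (mu h)) • (I Y ⊙ pack (mu h) ⊙ I H)
  = (I Y ⊙ pack (mu h)) • (I Y ⊙ I H ⊙ pack (mu h))).
{ transitivity (pack (idm Y ⊠ (mu h ∘ (mu h ⊠ idm H))));
    [|rewrite mu_assoc]; now strictify. }
assert (deltaA : (I X ⊙ pack (delta d) ⊙ I H) • (I X ⊙ pack (delta d))
  = (I X ⊙ I H ⊙ pack (delta d)) • (I X ⊙ pack (delta d))).
{ transitivity (pack (idm X ⊠ (asso H H H ∘ (delta d ⊠ idm H) ∘ delta d)));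
    [|rewrite delta_coassoc]; now strictify. }
assert (anti : (I Y ⊙ I H ⊙ pack (mu h)) • (I Y ⊙ I H ⊙ I H ⊙ pack (antipode h))
    • (I Y ⊙ I H ⊙ pack (delta d))
  = (I Y ⊙ I H ⊙ pack (eta h)) • (I Y ⊙ I H ⊙ pack (eps d))).
{ transitivity (pack (idm (Y ⊗ H) ⊠ (mu h ∘ (idm H ⊠ antipode h) ∘ delta d)));
    [|rewrite antipoder]; now strictify. }
assert (muU : (I Y ⊙ pack (mu h)) • (I Y ⊙ I H ⊙ pack (eta h)) = I (Y ⊗ H)).
{ transitivity (pack (idm Y ⊠ (mu h ∘ (idm H ⊠ eta h))));
    [|rewrite mu_unitr]; now strictify. }
assert (deltaU : (I X ⊙ I H ⊙ pack (eps d)) • (I X ⊙ pack (delta d)) = I (X ⊗ H)).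
{ transitivity (pack (idm X ⊠ ((idm H ⊠ eps d) ∘ delta d)));
    [|rewrite delta_counitr]; now strictify. }
pose proof (pack_slide (idm X ⊠ delta d) (antipode h)) as s1.
pose proof (pack_slide f (idm H ⊠ antipode h)) as s2.
pose proof (pack_slide f (delta d)) as s3.
pose proof (pack_slide f (eps d)) as s4.
rewrite !pack_tens, !pack_idtens, !atensA in s1.
rewrite !pack_tens, !pack_idtens, !atensA in s2.
rewrite !pack_idtens, !atensA in s3.
rewrite atens1r, !pack_idtens, !atensA in s4.
unfold rshear; rewrite tensm1, comp1m; apply pack_inj; strictify.
rewrite <- (acompA (I X ⊙ pack (delta d) ⊙ I H)), <- s1, !acompA, deltaA.
rewrite <- (acompA (pack f ⊙ I H ⊙ I H)), <- s2, !acompA.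
rewrite <- (acompA (pack f ⊙ I H ⊙ I H)), <- s3, !acompA.
rewrite <- (acompA (I Y ⊙ pack (mu h))), muA, !acompA.
rewrite <- (acompA _ _ ((pack f ⊙ I H) • _)), <- (acompA _ _ ((pack f ⊙ I H) • _)).
rewrite anti, acompA, <- (acompA (I Y ⊙ I H ⊙ pack (eps d))), s4, acompA, deltaU.
now rewrite <- acompA, muU, pack_comp_id, pack_id_comp.
Qed.

(** The composite with crossing [s] is h₁ · s(h₂ ⊗ k₁) · k₂, that is, [s] sheared on both sides, and
    both shears are injective. *)
Lemma hopf_mu_middle (f g : hom (H ⊗ H) (H ⊗ H)) :
  (mu h ⊠ mu h) ∘ middle H H f ∘ (delta d ⊠ delta d)
  = (mu h ⊠ mu h) ∘ middle H H g ∘ (delta d ⊠ delta d) -> f = g.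
Proof.
assert (e : forall s : hom (H ⊗ H) (H ⊗ H),
  (mu h ⊠ mu h) ∘ middle H H s ∘ (delta d ⊠ delta d)
  = lshear (idm H) (rshear (idm H) s)).
{ intros s; unfold lshear, rshear; rewrite !tensm1, !comp1m.
  rewrite <- (comp1m (mu h)) at 1; rewrite <- (compm1 (mu h)) at 2.
  rewrite <- (comp1m (delta d)) at 1; rewrite <- (compm1 (delta d)) at 2.
  rewrite !tensmM; apply pack_inj; unfold middle; strictify.
  pose proof (pack_slide (mu h) (mu h)) as sl; rewrite !pack_idtens, !atensA in sl.
  now rewrite <- acompA, sl, acompA. }
rewrite !e; intros e'.
now rewrite <- (rshearK f), <- (lshearK (rshear (idm H) f)), e', lshearK, rshearK.
Qed.

(* Since g = c^{-1} also fixes δ, both c and g can serve as the middle crossing in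
   the formula for δ ∘ μ, and [hopf_mu_middle] says that crossing is unique. *)
Theorem cocommutative_braid_sym :
  cocommutative d -> braid H H ∘ braid H H = idm (H ⊗ H).
Proof.
intros coc; destruct (braid_iso H H) as [g [gf fg]].
enough (g = braid H H) as -> by exact gf.
apply hopf_mu_middle.
assert (eb : (mu h ⊠ mu h) ∘ middle H H (braid H H) ∘ (delta d ⊠ delta d)
  = delta d ∘ mu h).
{ rewrite (proj2 (mu_coalg h)); unfold delta_tens; now rewrite compA. }
set (A := (mu h ⊠ mu h) ∘ middle H H g ∘ (delta d ⊠ delta d)).
(* Pushing c through μ ⊗ μ produces a middle crossing c that cancels [g], while the factor c ⊗ c is
   absorbed by the cocommutative coproducts. *)
assert (eA : braid H H ∘ A = delta d ∘ mu h).
{ unfold A; rewrite !compA, braid_nat, braid_tens_tens.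
  unfold middle_swap at 2; fold (middle H H (braid H H)).
  rewrite <- !compA, (compA _ (middle H H g)), middle_comp, fg, middle_id, comp1m.
  rewrite <- tensmM, coc, compA; exact eb. }
rewrite eb, <- (comp1m A), <- gf, <- compA, eA, <- coc, !compA, gf, comp1m.
now rewrite coc.
Qed.
End Schauenburg.

(** * Closure properties of coalgebra morphisms *)

Section CoalgebraMorphisms.
Variable C : strict_braided_category.

Lemma coalgebra_morphism_comp (X Y Z : C) (x : coalgebra_on X)
  (y : coalgebra_on Y) (z : coalgebra_on Z) (g : hom Y Z) (f : hom X Y) :
  coalgebra_morphism y z g -> coalgebra_morphism x y f ->
  coalgebra_morphism x z (g ∘ f).
Proof.
intros [g1 g2] [f1 f2]; split.
- now rewrite compA, g1.
- now rewrite compA, g2, <- compA, f2, compA, tensmM.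
Qed.

Lemma coalgebra_morphism_id (X : C) (x : coalgebra_on X) :
  coalgebra_morphism x x (idm X).
Proof. split; now rewrite ?tensm1, ?comp1m, ?compm1. Qed.

Lemma coalgebra_morphism_inverse (X Y : C)
  (x : coalgebra_on X) (y : coalgebra_on Y) (f : hom X Y) (g : hom Y X) :
  coalgebra_morphism x y f -> is_inverse f g -> coalgebra_morphism y x g.
Proof.
intros [f1 f2] [gf fg]; split.
- now rewrite <- f1, <- compA, fg, compm1.
- transitivity ((g ⊠ g) ∘ ((f ⊠ f) ∘ delta x) ∘ g).
  + now rewrite compA, <- tensmM, gf, tensm1, comp1m.
  + now rewrite <- f2, <- !compA, fg, compm1.
Qed.

End CoalgebraMorphisms.

(** * Convolution groups *)

Section Extensionality.
Variables (C : strict_braided_category) (H : C) (d : coalgebra_on H).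
Hypotheses (coc : cocommutative d) (sym : braid H H ∘ braid H H = idm (H ⊗ H)).

(** The Yoneda step: it suffices to test on the two projections of H ⊗ H, an admissible domain
    because c² = id makes it cocommutative. *)
Lemma pair_ext2 (X : C) (u v : hom (H ⊗ H) X) :
  (forall (D : C) (x : coalgebra_on D) (f g : hom D H), cocommutative x ->
    coalgebra_morphism x d f -> coalgebra_morphism x d g ->
    u ∘ pair x f g = v ∘ pair x f g) -> u = v.
Proof.
intros E; rewrite <- (compm1 u), <- (compm1 v), <- (pair_proj d d).
apply E; [apply coalg_tens_coc; assumption|apply proj1m_coalg|apply proj2m_coalg].
Qed.

(** The generic triple consists of the first projection of H ⊗ (H ⊗ H) and the two projections of
    its second factor. *)
Lemma pair_ext3 (X : C) (u v : hom (H ⊗ (H ⊗ H)) X) :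
  (forall (D : C) (x : coalgebra_on D) (f g k : hom D H), cocommutative x ->
    coalgebra_morphism x d f -> coalgebra_morphism x d g ->
    coalgebra_morphism x d k ->
    u ∘ pair x f (pair x g k) = v ∘ pair x f (pair x g k)) -> u = v.
Proof.
intros E; rewrite <- (compm1 u), <- (compm1 v).
rewrite <- (pair_proj d (coalg_tens d d)).
rewrite <- (comp1m (proj2m (H ⊗ H) d)), <- (pair_proj d d).
pose proof (proj2m_coalg d (coalg_tens d d)) as P2.
rewrite (pair_comp _ _ P2).
apply E.
- apply coalg_tens_coc; [assumption|now apply coalg_tens_coc|].
  now apply braid_sym_tens.
- apply proj1m_coalg.
- eapply coalgebra_morphism_comp; [apply proj1m_coalg|exact P2].
- eapply coalgebra_morphism_comp; [apply proj2m_coalg|exact P2].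
Qed.

Lemma pair_ext3l (X : C) (u v : hom ((H ⊗ H) ⊗ H) X) :
  (forall (D : C) (x : coalgebra_on D) (f g k : hom D H), cocommutative x ->
    coalgebra_morphism x d f -> coalgebra_morphism x d g ->
    coalgebra_morphism x d k ->
    u ∘ pair x (pair x f g) k = v ∘ pair x (pair x f g) k) -> u = v.
Proof.
intros E; enough (e : u ∘ assoV H H H = v ∘ assoV H H H).
{ rewrite <- (compm1 u), <- (compm1 v), <- assoVK, !compA.
  now rewrite e. }
apply pair_ext3; intros; rewrite <- !compA, pair_assocV; now apply E.
Qed.

End Extensionality.

Section Convolution.
Variables (C : strict_braided_category) (H : C) (e : coalgebra_on H).

Section Algebra.
Variables (D : C) (d : coalgebra_on D) (a : algebra_on H).

Definition conv (f g : hom D H) : hom D H := mu a ∘ pair d f g.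
Definition conv1 : hom D H := eta a ∘ eps d.

Lemma convA (f g k : hom D H) : conv (conv f g) k = conv f (conv g k).
Proof.
unfold conv; rewrite <- (comp1m k) at 1; rewrite <- (comp1m f) at 2.
rewrite <- !pair_tens, !compA, mu_assoc, <- !compA; now rewrite pair_assoc.
Qed.

Lemma conv1l (f : hom D H) : conv conv1 f = f.
Proof.
unfold conv, conv1; rewrite <- (comp1m f) at 1.
now rewrite <- pair_tens, compA, mu_unitl, pair_epsl.
Qed.

Lemma conv1r (f : hom D H) : conv f conv1 = f.
Proof.
unfold conv, conv1; rewrite <- (comp1m f) at 1.
now rewrite <- pair_tens, compA, mu_unitr, pair_epsr.
Qed.

Lemma conv_inv_unique (f g k : hom D H) :
  conv f g = conv1 -> conv g k = conv1 -> f = k.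
Proof. intros fg gk; now rewrite <- (conv1r f), <- gk, <- convA, fg, conv1l. Qed.

End Algebra.

Section Hopf.
Variable h : hopf_on e.
Variables (D : C) (d : coalgebra_on D).
Notation "f * g" := (conv d h f g).
Notation "1" := (conv1 d h).
Notation S f := (antipode h ∘ f).

Lemma conv_antipoder (f : hom D H) : coalgebra_morphism d e f -> f * S f = 1.
Proof.
intros Pf; unfold conv, conv1; rewrite <- (comp1m f) at 1.
rewrite <- pair_tens, <- (delta_pair Pf), !compA, antipoder, <- compA.
now rewrite (proj1 Pf).
Qed.

Lemma conv_antipodel (f : hom D H) : coalgebra_morphism d e f -> S f * f = 1.
Proof.
intros Pf; unfold conv, conv1; rewrite <- (comp1m f) at 2.
rewrite <- pair_tens, <- (delta_pair Pf), !compA, antipodel, <- compA.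
now rewrite (proj1 Pf).
Qed.

Lemma conv1_coalg : coalgebra_morphism d e 1.
Proof.
destruct (eta_coalg h) as [e1 e2]; unfold eps_unit, delta_unit in *; split.
- unfold conv1; now rewrite compA, e1, comp1m.
- unfold conv1; rewrite tensmM, compA, e2, <- !compA, eps_eps.
  now rewrite !compA.
Qed.

Hypothesis coc : cocommutative d.

Lemma conv_coalg (f g : hom D H) :
  coalgebra_morphism d e f -> coalgebra_morphism d e g ->
  coalgebra_morphism d e (f * g).
Proof.
intros Pf Pg; apply coalgebra_morphism_comp with (coalg_tens e e).
- exact (mu_coalg h).
- now apply pair_coalg.
Qed.

End Hopf.
End Convolution.

Section UnitLaws.
Variables (C : strict_braided_category) (H : C) (d : coalgebra_on H)
  (a : hom unit_ob H) (u : hom (H ⊗ H) H).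

(** The counit law rewrites ⟨a ∘ ε, id⟩ as a ⊗ id after the left unitor, so a unit law can be
    checked at the single point id. *)
Lemma pair_unitl : u ∘ pair d (a ∘ eps d) (idm H) = idm H ->
  u ∘ (a ⊠ idm H) = lunit H.
Proof.
intros e; transitivity (u ∘ (a ⊠ idm H) ∘ (lunitV H ∘ lunit H)).
- unfold lunit, lunitV; now rewrite eq_hom_symK, compm1.
- unfold pair in e; rewrite <- (comp1m (idm H)), tensmM, <- compA in e at 1.
  now rewrite delta_counitl, compA in e; rewrite compA, e, comp1m.
Qed.

Lemma pair_unitr : u ∘ pair d (idm H) (a ∘ eps d) = idm H ->
  u ∘ (idm H ⊠ a) = runit H.
Proof.
intros e; transitivity (u ∘ (idm H ⊠ a) ∘ (runitV H ∘ runit H)).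
- unfold runit, runitV; now rewrite eq_hom_symK, compm1.
- unfold pair in e; rewrite <- (comp1m (idm H)), tensmM, <- compA in e at 1.
  now rewrite delta_counitr, compA in e; rewrite compA, e, comp1m.
Qed.

End UnitLaws.

(** * The antipode of a cocommutative Hopf algebra *)

Section CocommutativeHopf.
Variables (C : strict_braided_category) (H : C) (e : coalgebra_on H)
  (h : hopf_on e).
Hypothesis coc : cocommutative e.

Definition shear (a : hom H H) : hom (H ⊗ H) (H ⊗ H) :=
  (idm H ⊠ mu h) ∘ asso H H H ∘ (((idm H ⊠ a) ∘ delta e) ⊠ idm H).

Lemma shear_pair (a : hom H H) (D : C) (d : coalgebra_on D) (f g : hom D H) :
  coalgebra_morphism d e f ->
  shear a ∘ pair d f g = pair d f (conv d h (a ∘ f) g).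
Proof.
intros Pf; unfold shear, conv.
rewrite <- !compA, pair_tens, <- compA, (delta_pair Pf), pair_tens, pair_assoc,
  pair_tens, !comp1m; reflexivity.
Qed.

(* The shear (x, y) |-> (x, xy) is an isomorphism of coalgebras, hence so is its
   inverse (x, y) |-> (x, λ(x) y), from which the antipode is recovered. *)
Lemma antipode_coalg : coalgebra_morphism e e (antipode h).
Proof.
pose proof (cocommutative_braid_sym h coc) as sym.
assert (Psh : coalgebra_morphism (coalg_tens e e) (coalg_tens e e)
  (shear (idm H))).
{ rewrite <- (compm1 (shear _)), <- (pair_proj e e).
  assert (P := proj1m_coalg e e); rewrite (shear_pair _ _ P), comp1m.
  assert (cc : cocommutative (coalg_tens e e)) by now apply coalg_tens_coc.
  apply pair_coalg; [exact cc|exact P|apply conv_coalg; trivial].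
  apply proj2m_coalg. }
assert (inv : is_inverse (shear (idm H)) (shear (antipode h))).
{ split; apply (pair_ext2 coc sym); intros D d f g cd Pf Pg;
    rewrite <- compA, !shear_pair, comp1m, <- convA by assumption.
  - now rewrite conv_antipodel, conv1l, comp1m.
  - now rewrite conv_antipoder, conv1l, comp1m. }
(* The inverse shear sends (x, 1) to (x, λ(x)). *)
assert (er : antipode h = proj2m H e ∘ (shear (antipode h)
  ∘ pair e (idm H) (conv1 e h))).
{ rewrite shear_pair, conv1r, pair_proj2, compm1; [reflexivity|apply compm1|].
  apply coalgebra_morphism_id. }
rewrite er.
apply coalgebra_morphism_comp with (coalg_tens e e); [apply proj2m_coalg|].
apply coalgebra_morphism_comp with (coalg_tens e e).
- now apply coalgebra_morphism_inverse with (shear (idm H)).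
- apply pair_coalg; [exact coc|apply coalgebra_morphism_id|apply conv1_coalg].
Qed.

Lemma antipode_pt (D : C) (d : coalgebra_on D) (f : hom D H) :
  coalgebra_morphism d e f -> coalgebra_morphism d e (antipode h ∘ f).
Proof. apply coalgebra_morphism_comp, antipode_coalg. Qed.

(** Both sides are convolution inverses of λ; for λ ∘ λ this uses that λ is itself a point, that is,
    a coalgebra morphism. *)
Lemma antipodeK : antipode h ∘ antipode h = idm H.
Proof.
apply (conv_inv_unique (d := e) (a := h)) with (antipode h).
- apply conv_antipodel, antipode_coalg.
- rewrite <- (compm1 (antipode h)); apply conv_antipodel, coalgebra_morphism_id.
Qed.

End CocommutativeHopf.

Section Gamma.
Variables (C : strict_braided_category) (H : C) (d : coalgebra_on H)
  (h1 h2 : hopf_on d).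

Lemma Gamma_pair (D : C) (x : coalgebra_on D) (f g : hom D H) :
  coalgebra_morphism x d f ->
  Gamma h1 h2 ∘ pair x f g = conv x h1 (antipode h1 ∘ f) (conv x h2 f g).
Proof.
intros Pf; unfold Gamma, conv.
now rewrite <- !compA, pair_tens, (delta_pair Pf), pair_assoc, pair_tens, comp1m.
Qed.

End Gamma.

(** * Hopf braces and brace triples *)

Section BraceToTriple.
Variables (C : strict_braided_category) (B : hopf_brace C).
Hypothesis coc : cocommutative (hb_coalg B).
Notation d := (hb_coalg B).
Notation h1 := (hb1 B).
Notation h2 := (hb2 B).

Section Points.
Variables (D : C) (x : coalgebra_on D).
Hypothesis cx : cocommutative x.
Notation pt f := (coalgebra_morphism x d f).
Notation "f * g" := (conv x h1 f g).
Notation "f ∙ g" := (conv x h2 f g) (at level 40, left associativity).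
Notation S f := (antipode h1 ∘ f).
Notation "f ▷ g" := (Gamma h1 h2 ∘ pair x f g) (at level 39).

Lemma hb_compat_pt (f g k : hom D B) : pt f -> f ∙ (g * k) = f ∙ g * (f ▷ k).
Proof.
intros Pf; pose proof (hb_compat B) as e.
apply (f_equal (fun u => u ∘ pair x f (pair x g k))) in e.
rewrite <- !compA, !pair_tens, (delta_pair Pf), !comp1m in e.
now rewrite pair_middle_swap, pair_tens in e.
Qed.

Lemma hb_unit_pt : conv1 x h1 = conv1 x h2.
Proof.
assert (P2 := conv1_coalg h2 x).
(* Compatibility at the unit u of ∘ and twice the unit 1 of · reduces to 1 = u⁻¹, the inverse being
   taken for ·; hence u = 1. *)
pose proof (hb_compat_pt (conv1 x h1) (conv1 x h1) P2) as e.
rewrite Gamma_pair in e by exact P2.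
rewrite !conv1l, !conv1r in e.
transitivity (conv1 x h2 * S (conv1 x h2)).
- now rewrite conv_antipoder.
- now rewrite <- e, conv1r.
Qed.

Lemma hb_act_mul (f g k : hom D B) : pt f -> f ▷ (g * k) = (f ▷ g) * (f ▷ k).
Proof.
intros Pf; rewrite (Gamma_pair h1 h2 (g * k) Pf), hb_compat_pt by exact Pf.
now rewrite <- convA, <- Gamma_pair.
Qed.

Lemma hb_mul_act (f g : hom D B) : pt f -> f * (f ▷ g) = f ∙ g.
Proof.
intros Pf; now rewrite Gamma_pair, <- convA, conv_antipoder, conv1l.
Qed.

Lemma hb_act_act (f g k : hom D B) : pt f -> pt g ->
  f ▷ (g ▷ k) = (f * (f ▷ g)) ▷ k.
Proof.
intros Pf Pg.
assert (Pfg : pt (f ∙ g)) by now apply conv_coalg.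
rewrite hb_mul_act, (Gamma_pair h1 h2 k Pfg) by exact Pf.
rewrite (Gamma_pair h1 h2 k Pg), hb_act_mul, !(Gamma_pair _ _ _ Pf) by exact Pf.
rewrite <- (convA x h2), <- !(convA x h1 _ _ (_ ∙ k)); f_equal.
(* It remains that f⁻¹ · (f ∘ g⁻¹) · f⁻¹ is the ·-inverse of f ∘ g. Multiplied by f ∘ g on the right
   it becomes f⁻¹ · (f ∘ (g⁻¹ · g)) by compatibility, which is 1. *)
apply (conv_inv_unique (d := x) (a := h1)) with (f ∙ g); [|now apply conv_antipoder].
rewrite !(convA x h1), <- (Gamma_pair h1 h2 g Pf), <- hb_compat_pt by exact Pf.
now rewrite conv_antipodel, hb_unit_pt, conv1r, <- hb_unit_pt, conv_antipodel.
Qed.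

End Points.

Lemma hb_unit : eta h1 = eta h2.
Proof.
pose proof (f_equal (fun u => u ∘ eta h1) (hb_unit_pt coc)) as e.
unfold conv1 in e; rewrite <- !compA, (proj1 (eta_coalg h1)) in e.
unfold eps_unit in e; now rewrite !compm1 in e.
Qed.

Notation γ := (Gamma h1 h2).
Notation T := (antipode h2).

Let sym : braid B B ∘ braid B B = idm (B ⊗ B) := cocommutative_braid_sym h1 coc.

Lemma hb_antipode_inverse : is_inverse (antipode h1) (antipode h1).
Proof. split; now apply antipodeK. Qed.

(** Evaluated at the two projections p and q, γ is p⁻¹ · (p ∘ q), and points are closed under both
    products and the antipode. *)
Lemma hb_gamma_coalg : coalgebra_morphism (coalg_tens d d) d γ.
Proof.
assert (cc : cocommutative (coalg_tens d d)) by now apply coalg_tens_coc.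
rewrite <- (compm1 γ), <- (pair_proj d d), Gamma_pair by apply proj1m_coalg.
apply conv_coalg; [exact cc|apply antipode_pt|apply conv_coalg]; try exact cc;
  try exact coc; first [apply proj1m_coalg|apply proj2m_coalg].
Qed.

Lemma hb_gamma_mul :
  γ ∘ (idm B ⊠ mu h1)
  = mu h1 ∘ (γ ⊠ γ) ∘ middle_swap B B B B ∘ (delta d ⊠ idm (B ⊗ B)).
Proof.
apply (pair_ext3 coc sym); intros D x f g k cx Pf Pg Pk.
rewrite <- !compA, !pair_tens, (delta_pair Pf), !comp1m.
rewrite pair_middle_swap, pair_tens by exact cx.
now apply hb_act_mul.
Qed.

Lemma hb_gamma_gamma :
  γ ∘ (idm B ⊠ γ)
  = γ ∘ ((mu h1 ∘ (idm B ⊠ γ) ∘ asso B B B ∘ (delta d ⊠ idm B)) ⊠ idm B)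
    ∘ assoV B B B.
Proof.
apply (pair_ext3 coc sym); intros D x f g k cx Pf Pg Pk.
rewrite <- !compA, pair_assocV, !pair_tens, <- !compA, pair_tens, (delta_pair Pf).
rewrite pair_assoc, pair_tens, !comp1m.
now apply hb_act_act.
Qed.

Lemma hb_gamma_unit : γ ∘ (eta h1 ⊠ idm B) = lunit B.
Proof.
apply pair_unitl with d.
change (γ ∘ pair d (conv1 d h1) (idm B) = idm B).
rewrite Gamma_pair by apply conv1_coalg.
rewrite (hb_unit_pt coc) at 2; rewrite conv1l, <- (conv1l d h1 (_ ∘ _)).
rewrite conv_antipoder by apply conv1_coalg; apply conv1l.
Qed.

Lemma hb_T_delta : delta d ∘ T = braid B B ∘ (T ⊠ T) ∘ delta d.
Proof.
rewrite braid_nat, <- compA, coc; apply (antipode_coalg h2 coc).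
Qed.

Lemma hb_T_eps : eps d ∘ T = eps d.
Proof. apply (antipode_coalg h2 coc). Qed.

(** At the point id = x: x ▷ T(x) = x⁻¹ · (x ∘ T(x)) = x⁻¹, because T inverts for ∘ and the two
    units agree. *)
Lemma hb_gamma_T : γ ∘ (idm B ⊠ T) ∘ delta d = antipode h1.
Proof.
rewrite <- compA; change (γ ∘ ((idm B ⊠ T) ∘ delta d) = antipode h1).
assert (P := coalgebra_morphism_id d).
rewrite <- pair_id, pair_tens, Gamma_pair by now rewrite comp1m.
rewrite comp1m, (conv_antipoder h2 P), <- (hb_unit_pt coc), conv1r; apply compm1.
Qed.

Lemma hb_T_gamma : γ ∘ (T ⊠ idm B) ∘ delta d = antipode h1 ∘ T.
Proof.
assert (P := coalgebra_morphism_id d).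
assert (PT : coalgebra_morphism d d (T ∘ idm B)) by now apply antipode_pt.
rewrite <- compA, <- pair_id, pair_tens, Gamma_pair, comp1m by exact PT.
now rewrite (conv_antipodel h2 P), <- (hb_unit_pt coc), conv1r, compm1.
Qed.

Lemma hb_T_mul :
  mu h1 ∘ (idm B ⊠ γ) ∘ asso B B B ∘ ((delta d ∘ T) ⊠ idm B)
  = mu h1 ∘ (idm B ⊠ γ) ∘ asso B B B ∘ (((T ⊠ T) ∘ delta d) ⊠ idm B).
Proof. now rewrite (proj2 (antipode_coalg h2 coc)). Qed.

Lemma hb_gamma_braid :
  (γ ⊠ idm B) ∘ assoV B B B ∘ (idm B ⊠ braid B B) ∘ asso B B B ∘ (delta d ⊠ idm B)
  = (γ ⊠ idm B) ∘ assoV B B B ∘ (idm B ⊠ braid B B) ∘ asso B B B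
    ∘ ((braid B B ∘ delta d) ⊠ idm B).
Proof. now rewrite coc. Qed.

(** Any inverse of the antipode is the antipode itself, which is an involution here. *)
Lemma hb_T_gamma_inverse (antipodeV : hom B B) :
  is_inverse (antipode h1) antipodeV ->
  γ ∘ (T ⊠ idm B) ∘ delta d = antipodeV ∘ T.
Proof.
intros [e _]; rewrite hb_T_gamma; f_equal.
rewrite <- (comp1m (antipode h1)), <- e, <- compA.
now rewrite antipodeK, compm1.
Qed.

Definition triple_of_brace : brace_triple C :=
  BraceTriple (bt_hopf := h1)
    (ex_intro _ _ hb_antipode_inverse) hb_gamma_braid hb_gamma_coalg
    hb_gamma_mul hb_gamma_gamma hb_gamma_unit
    (ex_intro _ T (conj (antipodeK h2 coc) (antipodeK h2 coc)))
    hb_T_delta hb_T_eps hb_T_mul hb_gamma_T hb_T_gamma_inverse.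

End BraceToTriple.

(** * From brace triples to Hopf braces *)

Section TripleToBrace.
Variables (C : strict_braided_category) (T : brace_triple C).
Hypothesis coc : cocommutative (bt_coalg T).
Notation d := (bt_coalg T).
Notation h := (bt_hopf T).
Notation γ := (bt_gamma T).

Definition mu2 : hom (T ⊗ T) T :=
  mu h ∘ (idm T ⊠ γ) ∘ asso T T T ∘ (delta d ⊠ idm T).

Let sym : braid T T ∘ braid T T = idm (T ⊗ T) := cocommutative_braid_sym h coc.

Section Points.
Variables (D : C) (x : coalgebra_on D).
Hypothesis cx : cocommutative x.
Notation pt f := (coalgebra_morphism x d f).
Notation "f * g" := (conv x h f g).
Notation S f := (antipode h ∘ f).
Notation "f ▷ g" := (γ ∘ pair x f g) (at level 39).
Notation "f ∙ g" := (mu2 ∘ pair x f g) (at level 40, left associativity).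

Lemma bt_act_mul (f g k : hom D T) : pt f -> f ▷ (g * k) = (f ▷ g) * (f ▷ k).
Proof.
intros Pf; pose proof (bt_iii T) as e.
apply (f_equal (fun u => u ∘ pair x f (pair x g k))) in e.
rewrite <- !compA, !pair_tens, (delta_pair Pf), !comp1m in e.
now rewrite pair_middle_swap, pair_tens in e.
Qed.

Lemma mu2_pair (f g : hom D T) : pt f -> f ∙ g = f * (f ▷ g).
Proof.
intros Pf; unfold mu2, conv.
now rewrite <- !compA, pair_tens, (delta_pair Pf), pair_assoc, pair_tens, !comp1m.
Qed.

Lemma bt_act_act (f g k : hom D T) : pt f -> f ▷ (g ▷ k) = (f ∙ g) ▷ k.
Proof.
intros Pf; pose proof (bt_iv T) as e; fold mu2 in e.
apply (f_equal (fun u => u ∘ pair x f (pair x g k))) in e.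
now rewrite <- !compA, pair_assocV, !pair_tens, !comp1m in e.
Qed.

Lemma act_coalg (f g : hom D T) : pt f -> pt g -> pt (f ▷ g).
Proof.
intros Pf Pg; apply coalgebra_morphism_comp with (coalg_tens d d).
- exact (bt_ii T).
- now apply pair_coalg.
Qed.

Lemma mu2_pt (f g : hom D T) : pt f -> pt g -> pt (f ∙ g).
Proof.
intros Pf Pg; rewrite mu2_pair by exact Pf.
apply conv_coalg; [exact cx|exact Pf|now apply act_coalg].
Qed.

(** Both sides equal f · (f ▷ g) · (f ▷ (g ▷ k)): the action is by endomorphisms of · and is
    compatible with ∘. *)
Lemma mu2_assoc_pt (f g k : hom D T) : pt f -> pt g ->
  (f ∙ g) ∙ k = f ∙ (g ∙ k).
Proof.
intros Pf Pg.
assert (Pfg := mu2_pt Pf Pg).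
rewrite (mu2_pair k Pfg), <- bt_act_act, (mu2_pair (g ∙ k) Pf) by exact Pf.
rewrite (mu2_pair k Pg), bt_act_mul, (mu2_pair g Pf) by exact Pf.
apply convA.
Qed.

(** Acting on 1 · 1 = 1 shows that f ▷ 1 is idempotent for ·, and an idempotent in a group is the
    unit. *)
Lemma bt_act_unit (f : hom D T) : pt f -> f ▷ conv1 x h = conv1 x h.
Proof.
intros Pf; set (u := f ▷ conv1 x h).
assert (Pu : pt u) by (apply act_coalg; [exact Pf|apply conv1_coalg]).
assert (e : u * u = u) by (unfold u; now rewrite <- bt_act_mul, conv1l).
now rewrite <- (conv1l x h u), <- (conv_antipodel h Pu), convA, e.
Qed.

Lemma unit_act (f : hom D T) : conv1 x h ▷ f = f.
Proof.
unfold conv1; rewrite <- (comp1m f) at 1.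
now rewrite <- pair_tens, compA, bt_v, pair_epsl.
Qed.

Lemma Gamma_mu2_pt (f g : hom D T) : pt f -> S f * (f ∙ g) = f ▷ g.
Proof.
intros Pf; now rewrite mu2_pair, <- convA, conv_antipodel, conv1l.
Qed.

End Points.

Lemma mu2_assoc :
  mu2 ∘ (mu2 ⊠ idm T) = mu2 ∘ (idm T ⊠ mu2) ∘ asso T T T.
Proof.
apply (pair_ext3l coc sym); intros D x f g k cx Pf Pg Pk.
rewrite <- !compA, pair_assoc, !pair_tens, !comp1m.
now apply mu2_assoc_pt.
Qed.

Lemma mu2_unitl : mu2 ∘ (eta h ⊠ idm T) = lunit T.
Proof.
apply pair_unitl with d; change (mu2 ∘ pair d (conv1 d h) (idm T) = idm T).
now rewrite mu2_pair, unit_act, conv1l by apply conv1_coalg.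
Qed.

Lemma mu2_unitr : mu2 ∘ (idm T ⊠ eta h) = runit T.
Proof.
apply pair_unitr with d; change (mu2 ∘ pair d (idm T) (conv1 d h) = idm T).
assert (P := coalgebra_morphism_id d).
now rewrite mu2_pair, bt_act_unit, conv1r.
Qed.

Lemma mu2_coalg : coalgebra_morphism (coalg_tens d d) d mu2.
Proof.
rewrite <- (compm1 mu2), <- (pair_proj d d).
apply mu2_pt; [now apply coalg_tens_coc|apply proj1m_coalg|apply proj2m_coalg].
Qed.

Lemma bt_T_coalg : coalgebra_morphism d d (bt_T T).
Proof.
split; [apply bt_vi2|].
now rewrite bt_vi1, braid_nat, <- compA, coc.
Qed.

(** Here x ∘ T(x) = x · (x ▷ T(x)) = x · λ(x) by (vi.4). *)
Lemma mu2_T : mu2 ∘ (idm T ⊠ bt_T T) ∘ delta d = eta h ∘ eps d.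
Proof.
assert (P := coalgebra_morphism_id d).
rewrite <- compA; change (mu2 ∘ pair d (idm T) (bt_T T) = conv1 d h).
rewrite mu2_pair by exact P; unfold pair; rewrite compA, bt_vi4.
rewrite <- (compm1 (antipode h)); now apply conv_antipoder.
Qed.

Lemma T_mu2 : mu2 ∘ (bt_T T ⊠ idm T) ∘ delta d = eta h ∘ eps d.
Proof.
assert (P := bt_T_coalg).
rewrite <- compA; change (mu2 ∘ pair d (bt_T T) (idm T) = conv1 d h).
rewrite mu2_pair by exact P; unfold pair; rewrite compA.
(* As λ is its own inverse, (vi.5) gives T(x) ▷ x = λ(T(x)), so T(x) ∘ x = T(x) · λ(T(x)). *)
rewrite (bt_vi5 (antipodeV := antipode h)); [now apply conv_antipoder|].
split; now apply antipodeK.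
Qed.

Definition hopf2 : hopf_on d :=
  HopfOn (hopf_alg := AlgebraOn mu2_assoc mu2_unitl mu2_unitr)
    (eta_coalg h) mu2_coalg mu2_T T_mu2.

Lemma Gamma_mu2 : Gamma h hopf2 = γ.
Proof.
apply (pair_ext2 coc sym); intros D x f g cx Pf Pg.
rewrite Gamma_pair by exact Pf; exact (Gamma_mu2_pt g Pf).
Qed.

Lemma hopf2_compat :
  mu hopf2 ∘ (idm T ⊠ mu h)
  = mu h ∘ (mu hopf2 ⊠ Gamma h hopf2) ∘ middle_swap T T T T
    ∘ (delta d ⊠ idm (T ⊗ T)).
Proof.
rewrite Gamma_mu2; apply (pair_ext3 coc sym); intros D x f g k cx Pf Pg Pk.
rewrite <- !compA, !pair_tens, (delta_pair Pf), !comp1m.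
rewrite pair_middle_swap, pair_tens by exact cx; simpl.
change (mu2 ∘ pair x f (conv x h g k) = conv x h (mu2 ∘ pair x f g) (γ ∘ pair x f k)).
rewrite !mu2_pair, bt_act_mul by assumption; symmetry; apply convA.
Qed.

Definition brace_of_triple : hopf_brace C := HopfBrace hopf2_compat.

End TripleToBrace.

(** * Round trips on objects, and transfer of morphisms *)

Lemma algebra_on_eq (C : strict_braided_category) (A : C) (a b : algebra_on A) :
  eta a = eta b -> mu a = mu b -> a = b.
Proof.
destruct a, b; simpl; intros; subst; f_equal; apply proof_irrelevance.
Qed.

Lemma hopf_on_eq (C : strict_braided_category) (H : C) (d : coalgebra_on H)
  (h k : hopf_on d) :
  eta h = eta k -> mu h = mu k -> antipode h = antipode k -> h = k.
Proof.
intros e1 e2; pose proof (algebra_on_eq e1 e2) as e; revert e; clear e1 e2.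
destruct h, k; simpl; intros; subst; f_equal; apply proof_irrelevance.
Qed.

(** The round trip rebuilds only the second structure; keeping the other data fixed avoids transport
    along equalities. Likewise only γ varies in [brace_triple_eq]. *)
Lemma hopf_brace_eq (C : strict_braided_category) (B : hopf_brace C)
  (h : hopf_on (hb_coalg B)) compat :
  h = hb2 B -> @HopfBrace C (hb_ob B) (hb_coalg B) (hb1 B) h compat = B.
Proof.
intros ->; destruct B; simpl; f_equal; apply proof_irrelevance.
Qed.

Lemma brace_triple_eq (C : strict_braided_category) (t : brace_triple C)
  (g : hom (t ⊗ t) t) p0 p1 p2 p3 p4 p5 p6 p7 p8 p9 p10 p11 :
  g = bt_gamma t ->
  @BraceTriple C (bt_ob t) (bt_coalg t) (bt_hopf t) g (bt_T t)
    p0 p1 p2 p3 p4 p5 p6 p7 p8 p9 p10 p11 = t.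
Proof.
intros ->; destruct t; simpl; f_equal; apply proof_irrelevance.
Qed.

Lemma brace_of_tripleK (C : strict_braided_category) (B : hopf_brace C)
  (coc : cocommutative (hb_coalg B)) :
  brace_of_triple (T := triple_of_brace coc) coc = B.
Proof.
(* The rebuilt second structure carries the unit of the first, hence [hb_unit]; its antipode is T,
   defined as the original second antipode. The products remain to be compared. *)
apply hopf_brace_eq, hopf_on_eq; [exact (hb_unit coc)| |reflexivity].
apply (pair_ext2 coc (cocommutative_braid_sym (hb1 B) coc)).
intros D x f g cx Pf Pg.
refine (eq_trans (mu2_pair (T := triple_of_brace coc) g Pf) _).
exact (hb_mul_act g Pf).
Qed.

Lemma triple_of_braceK (C : strict_braided_category) (t : brace_triple C)
  (coc : cocommutative (bt_coalg t)) :
  triple_of_brace (B := brace_of_triple coc) coc = t.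
Proof. apply brace_triple_eq, Gamma_mu2. Qed.

(** Both composites are convolution inverses of f. *)
Lemma hopf_morphism_antipode (C : strict_braided_category) (H B : C)
  (d : coalgebra_on H) (e : coalgebra_on B) (h : hopf_on d) (b : hopf_on e)
  (f : hom H B) : hopf_morphism h b f -> f ∘ antipode h = antipode b ∘ f.
Proof.
intros [[f1 f2] Pf].
apply (conv_inv_unique (d := d) (a := b)) with f; [|now apply conv_antipoder].
unfold conv, conv1; rewrite <- (compm1 f) at 2.
rewrite <- pair_tens, compA, <- f2, <- compA.
change (f ∘ (mu h ∘ ((antipode h ⊠ idm H) ∘ delta d)) = eta b ∘ eps d).
now rewrite (compA (mu h)), antipodel, compA, f1.
Qed.

(** A morphism of Hopf braces respects δ, λ¹, μ¹ and μ², from which γ is composed. *)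
Lemma triple_of_brace_morphism (C : strict_braided_category)
  (A B : hopf_brace C) (cA : cocommutative (hb_coalg A))
  (cB : cocommutative (hb_coalg B)) (f : hom A B) :
  hopf_brace_morphism (H := A) (B := B) f ->
  brace_triple_morphism (H := triple_of_brace cA) (B := triple_of_brace cB) f.
Proof.
intros [P1 P2]; split; [exact P1|simpl].
pose proof (hopf_morphism_antipode P1) as eS.
destruct P1 as [[_ m1] [_ D1]], P2 as [[_ m2] _].
unfold Gamma.
rewrite <- (compA _ (delta (hb_coalg B) ⊠ _)), <- tensmM, D1, comp1m.
rewrite <- (compm1 f) at 4; rewrite tensmM, !compA.
rewrite <- (compA _ (asso B B B)); unfold asso at 2; rewrite tensmA, !compA.
now rewrite <- (compA (mu (hb1 B))), <- tensmM, <- eS, <- m2, tensmM, compA, <- m1.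
Qed.

Lemma brace_of_triple_morphism (C : strict_braided_category)
  (A B : brace_triple C) (cA : cocommutative (bt_coalg A))
  (cB : cocommutative (bt_coalg B)) (f : hom A B) :
  brace_triple_morphism (H := A) (B := B) f ->
  hopf_brace_morphism (H := brace_of_triple cA) (B := brace_of_triple cB) f.
Proof.
intros [P1 eg]; split; [exact P1|].
destruct P1 as [[e1 m1] P]; split; [split; [exact e1|]|exact P].
simpl.
unfold mu2; rewrite <- (compA _ (delta (bt_coalg B) ⊠ _)), <- tensmM, (proj2 P).
rewrite comp1m; rewrite <- (compm1 f) at 4; rewrite tensmM, !compA.
rewrite <- (compA _ (asso B B B)); unfold asso at 2; rewrite tensmA, !compA.
rewrite <- (compA (mu _)), <- tensmM, comp1m, <- eg.
rewrite <- (compm1 f) at 2; now rewrite tensmM, compA, <- m1.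
Qed.

(** The actions on morphisms have different types until the object maps are identified, so they are
    compared in squares with identities [eq_hom]. *)
Lemma functor_eq_id (A : category) (F : functor A A)
  (e : forall X, F X = X) :
  (forall (X Y : A) (f : hom X Y), eq_hom (e Y) ∘ fhom F f = f ∘ eq_hom (e X)) ->
  F = functor_id A.
Proof.
destruct F as [o m m1 mM]; simpl in *; intros E.
assert (eo : o = fun X => X) by now apply functional_extensionality.
subst o.
assert (em : m = fun X Y f => f).
{ do 3 (apply functional_extensionality_dep; intro).
  specialize (E x x0 x1); now rewrite !eq_hom_id, comp1m, compm1 in E. }
subst m; unfold functor_id; f_equal; apply proof_irrelevance.
Qed.

(** * The two functors and their composites *)

Section Isomorphism.
Variable C : strict_braided_category.

Definition brace_to_triple : functor (cocHBr C) (cocBT C).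
Proof.
refine (@Functor (cocHBr C) (cocBT C)
    (fun B => exist _ (triple_of_brace (proj2_sig B)) (proj2_sig B))
    (fun A B f => exist _ (proj1_sig f)
      (triple_of_brace_morphism (proj2_sig A) (proj2_sig B) (proj2_sig f)))
    _ _); intros; now apply sig_hom_eq.
Defined.

Definition triple_to_brace : functor (cocBT C) (cocHBr C).
Proof.
refine (@Functor (cocBT C) (cocHBr C)
    (fun t => exist _ (brace_of_triple (proj2_sig t)) (proj2_sig t))
    (fun A B f => exist _ (proj1_sig f)
      (brace_of_triple_morphism (proj2_sig A) (proj2_sig B) (proj2_sig f)))
    _ _); intros; now apply sig_hom_eq.
Defined.

(** Reduces a square along equalities of braces to one in C. The equalities [oX] and [oY] of
    underlying objects are independent of [eX] and [eY], so that trivial ones can be chosen. *)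
Lemma cocHBr_square (X X' Y Y' : cocHBr C) (eX : X' = X) (eY : Y' = Y)
  (g : hom X' Y') (f : hom X Y)
  (oX : hb_ob (proj1_sig X') = hb_ob (proj1_sig X))
  (oY : hb_ob (proj1_sig Y') = hb_ob (proj1_sig Y)) :
  eq_hom oY ∘ proj1_sig g = proj1_sig f ∘ eq_hom oX ->
  eq_hom eY ∘ g = f ∘ eq_hom eX.
Proof.
destruct eX, eY; rewrite (eq_hom_id oX), (eq_hom_id oY); intros e.
now apply sig_hom_eq.
Qed.

Lemma cocBT_square (X X' Y Y' : cocBT C) (eX : X' = X) (eY : Y' = Y)
  (g : hom X' Y') (f : hom X Y)
  (oX : bt_ob (proj1_sig X') = bt_ob (proj1_sig X))
  (oY : bt_ob (proj1_sig Y') = bt_ob (proj1_sig Y)) :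
  eq_hom oY ∘ proj1_sig g = proj1_sig f ∘ eq_hom oX ->
  eq_hom eY ∘ g = f ∘ eq_hom eX.
Proof.
destruct eX, eY; rewrite (eq_hom_id oX), (eq_hom_id oY); intros e.
now apply sig_hom_eq.
Qed.

End Isomorphism.

Theorem corollary2p19 (C : strict_braided_category) :
  isomorphic_categories (cocHBr C) (cocBT C).
Proof.
exists (brace_to_triple C), (triple_to_brace C); split.
- apply functor_eq_id with (fun X : cocHBr C => sig_hom_eq
    (u := triple_to_brace C (brace_to_triple C X))
    (brace_of_tripleK (proj2_sig X))).
  (* The round trip fixes underlying objects and morphisms by computation, so [eq_refl] serves for
     both objects and only unit laws remain. *)
  intros X Y f; refine (@cocHBr_square C X (triple_to_brace C (brace_to_triple C X))
    Y (triple_to_brace C (brace_to_triple C Y)) _ _ _ f eq_refl eq_refl _).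
  exact (eq_trans (comp1m _) (eq_sym (compm1 _))).
- apply functor_eq_id with (fun X : cocBT C => sig_hom_eq
    (u := brace_to_triple C (triple_to_brace C X))
    (triple_of_braceK (proj2_sig X))).
  intros X Y f; refine (@cocBT_square C X (brace_to_triple C (triple_to_brace C X))
    Y (brace_to_triple C (triple_to_brace C Y)) _ _ _ f eq_refl eq_refl _).
  exact (eq_trans (comp1m _) (eq_sym (compm1 _))).
Qed.
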